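(* For every $\varepsilon\in(0,1/2)$ and $\eta,\rho\in(0,1/4)$ there exist an integer $K\ge1$, constants $c,\mu,M>0$ and an integer $n_0$, depending only on $\varepsilon,\eta,\rho$, with the following property. Let $n\ge n_0$, $p\in(0,1]$ and $pn\ge M$. Let $G$ be an $n$-vertex $(p,\beta)$-bijumbled graph with $\beta\le cpn$, and let $H$ be either an absolute $\varepsilon$-Dirac subgraph of $G$ at density $p$, or a relative $\varepsilon$-Dirac subgraph of $G$ where in addition $\delta(G)\ge(1-\varepsilon/4)pn$. Then for every conflict graph $\Gamma$ on $E(H)$ with $\Delta(\Gamma)\le\mu pn$, there is a probability measure $\lambda$ on $\Gamma$-conflict-free spanning subgraphs $F\subseteq H$ such that every graph $F$ in its support is $(\eta,\rho,K/n)$-sparse and satisfies $$\delta(F)\ge\left(\frac12+\frac\varepsilon4\right)K\quad\text{and}\quad e(F)\le2Kn.$$ Moreover, for every $S\subseteq E(H)$, $$\lambda[S\subseteq E(F)]\le\left(\frac{K}{pn}\right)^{|S|}\left(\frac43\right)^{|V(S)|}\le\left(\frac{16K}{9pn}\right)^{|S|},$$ where $V(S)$ is the set of vertices incident with at least one edge in $S$.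
   Context: Graphs are finite and simple; $\delta,\Delta$ denote minimum and maximum degree, and $e(F)=|E(F)|$. For $A,B\subseteq V(G)$ (not necessarily disjoint), $e_G(A,B)$ is the number of ordered pairs $(a,b)\in A\times B$ with $ab\in E(G)$. A graph $G$ is $(p,\beta)$-bijumbled if $\bigl|e_G(A,B)-p|A||B|\bigr|\le\beta\sqrt{|A||B|}$ for all $A,B\subseteq V(G)$. A spanning subgraph $H$ of an $n$-vertex graph $G$ is an absolute $\varepsilon$-Dirac subgraph of $G$ at density $p$ if $\delta(H)\ge(\tfrac12+\varepsilon)pn$. It is a relative $\varepsilon$-Dirac subgraph of $G$ if $\deg_H(v)\ge(\tfrac12+\varepsilon)\deg_G(v)$ for every $v\in V(G)$. A conflict graph $\Gamma$ on $E(H)$ is a graph with vertex set $E(H)$. A subgraph of $H$ is $\Gamma$-conflict-free if its edge set is an independent set in $\Gamma$. For $\eta,\rho,r>0$, an $n$-vertex graph $F$ is $(\eta,\rho,r)$-sparse if $e_F(U,W)\le(1+\rho)\eta rn|U|$ for all $U,W\subseteq V(F)$ (not necessarily disjoint) with $\eta rn\le|U|=|W|\le\eta n$. The support of a measure on a finite family is the set of members assigned positive mass; $\lambda[S\subseteq E(F)]$ denotes the probability that a graph $F$ with law $\lambda$ contains all edges of $S$. *)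

(* Defs.v *)
From HB Require Import structures.
From mathcomp Require Import all_boot all_order all_algebra.
From mathcomp Require Import reals.

Set Implicit Arguments.
Unset Strict Implicit.
Unset Printing Implicit Defensive.

Import Order.TTheory GRing.Theory Num.Theory.

Local Open Scope ring_scope.

(* A finite simple graph is identified with its edge set, a family of
   two-element subsets of V. *)
Record sgraph (V : finType) := SGraph {
  edges : {set {set V}};
  edgesP : [forall e in edges, #|e| == 2]
}.

HB.instance Definition _ (V : finType) := [isSub for @edges V].
HB.instance Definition _ (V : finType) := [Finite of sgraph V by <:].

Section Graphs.
Variable V : finType.
Implicit Types (G H F : sgraph V) (A B : {set V}).

Definition adj G (x y : V) : bool := [set x; y] \in edges G.

Definition deg G (v : V) : nat := #|[set u | adj G v u]|.

(* The default value #|V| exceeds every degree, so it matters only when V is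
   empty. *)
Definition min_degree G : nat := \big[minn/#|V|]_(v : V) deg G v.

Definition max_degree G : nat := (\max_(v : V) deg G v)%N.

Definition num_edges G : nat := #|edges G|.

(* Ordered pairs: an edge inside A :&: B is counted twice. *)
Definition edges_between G A B : nat :=
  #|[set ab in setX A B | adj G ab.1 ab.2]|.

(* All graphs of type [sgraph V] have vertex set V, so subgraphs are spanning. *)
Definition spanning_subgraph H G : bool := edges H \subset edges G.

Definition independent G A : bool :=
  [forall x in A, forall y in A, ~~ adj G x y].

End Graphs.

Section Dirac.
Variables (R : realType) (V : finType).
Implicit Types G H F : sgraph V.

Definition bijumbled (p beta : R) G : Prop :=
  forall A B : {set V},
    `|(edges_between G A B)%:R - p * #|A|%:R * #|B|%:R|
      <= beta * Num.sqrt (#|A|%:R * #|B|%:R).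

Definition absolute_Dirac (eps p : R) H G : Prop :=
  spanning_subgraph H G /\
  (1 / 2 + eps) * p * #|V|%:R <= (min_degree H)%:R.

Definition relative_Dirac (eps : R) H G : Prop :=
  spanning_subgraph H G /\
  forall v : V, (1 / 2 + eps) * (deg G v)%:R <= (deg H v)%:R.

Definition sparse (eta rho r : R) F : Prop :=
  forall U W : {set V},
    #|U| = #|W| ->
    eta * r * #|V|%:R <= #|U|%:R ->
    #|U|%:R <= eta * #|V|%:R ->
    (edges_between F U W)%:R <= (1 + rho) * eta * r * #|V|%:R * #|U|%:R.

End Dirac.

Definition conflict_graph (V : finType) (H : sgraph V) : Type :=
  sgraph {e : {set V} | e \in edges H}.

Definition conflict_free (V : finType) (H : sgraph V) (Gamma : conflict_graph H)
    (F : sgraph V) : bool :=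
  independent Gamma [set e | val e \in edges F].

Definition conflict_free_subgraphs (V : finType) (H : sgraph V)
    (Gamma : conflict_graph H) : {set sgraph V} :=
  [set F | spanning_subgraph F H && conflict_free Gamma F].

Section FiniteProbability.
Variables (R : realType) (T : finType).

Definition probability_on (D : {set T}) (lambda : {ffun T -> R}) : Prop :=
  [/\ forall x, 0 <= lambda x,
      forall x, x \notin D -> lambda x = 0
    & \sum_(x in D) lambda x = 1].

Definition law_support (lambda : {ffun T -> R}) : {set T} :=
  [set x | 0 < lambda x].

Definition prob (lambda : {ffun T -> R}) (P : pred T) : R :=
  \sum_(x | P x) lambda x.

End FiniteProbability.

(* Main.v *)
(* Both Dirac hypotheses give delta(H) >= (1/2 + 3 eps/4) p n, and bijumbledness
   is only used as an upper bound on edge counts. First H is thinned to a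
   subgraph H' with delta(H') >= (1/2 + eps/2) p n and Delta(H') <= 3 p n.
   Keep each edge of H' independently with probability q = K/(p n) and condition
   on three requirements:
     - every degree is at least (1/2 + eps/4) K;
     - the sample contains no set of a family J of edge sets, made of the
       conflicting pairs and of the sets T :|: S, where T is a small tree and S
       consists of L |V(T)| further edges inside V(T);
     - no pair (U, W) with |U| = |W| linear in n violates sparsity, and there
       are at most 2 K n edges.
   Avoiding J forces every small vertex set to span few edges, which yields
   sparsity for small pairs. The degree requirements are increasing events and
   avoiding J is decreasing, so Harris' inequality gives a local lemma in which
   each vertex costs only a constant factor 5/4, whatever the degrees of H' are;
   this is where the factor (4/3)^|V(S)| comes from. The sum over trees through a
   vertex is controlled by percolation: the events that the cluster of the
   vertex is exactly T are disjoint. The last requirement fails with probability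
   exponentially small in n with a large rate, by Chernoff and a union bound,
   hence it survives the conditioning. *)
Require Import Defs.
From mathcomp Require Import all_boot all_order all_algebra.
From mathcomp Require Import reals sequences exp.
From mathcomp Require Import lra ring.

Set Implicit Arguments.
Unset Strict Implicit.
Unset Printing Implicit Defensive.

Import Order.TTheory GRing.Theory Num.Theory.

Local Open Scope ring_scope.

(** * Random subsets and Harris' inequality *)

Section RandomSubset.
Variables (R : realType) (T : finType) (q : R).
Hypothesis q01 : 0 <= q <= 1.
Implicit Types (X Y S D : {set T}) (f g h : {set T} -> R) (P Q : pred {set T}).

Definition weight X : R := \prod_t (if t \in X then q else 1 - q).
Definition expect f : R := \sum_X weight X * f X.
Definition Pr P : R := expect (fun X => (P X)%:R).

Lemma weight_ge0 X : 0 <= weight X.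
Proof.
case/andP: q01 => q0 q1.
by apply: prodr_ge0 => t _; case: ifP => // _; rewrite subr_ge0.
Qed.

(** Independence of the coordinates: expanding the product of the binomials
    [q * a t + (1 - q) * b t] gives one term for each subset X of T. *)
Lemma expect_prod (a b : T -> R) :
  expect (fun X => \prod_t (if t \in X then a t else b t)) =
  \prod_t (q * a t + (1 - q) * b t).
Proof.
rewrite bigA_distr /expect; apply: eq_bigr => X _.
by rewrite -big_split; apply: eq_bigr => t _; case: ifP.
Qed.

Lemma eq_expect f g : f =1 g -> expect f = expect g.
Proof. by move=> fg; apply: eq_bigr => X _; rewrite fg. Qed.

Lemma ler_expect f g : (forall X, f X <= g X) -> expect f <= expect g.
Proof. by move=> fg; apply: ler_sum => X _; rewrite ler_wpM2l ?weight_ge0. Qed.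

Lemma expectD f g : expect (fun X => f X + g X) = expect f + expect g.
Proof. by rewrite -big_split; apply: eq_bigr => X _; rewrite mulrDr. Qed.

Lemma expectZ a f : expect (fun X => a * f X) = a * expect f.
Proof. by rewrite /expect mulr_sumr; apply: eq_bigr => X _; rewrite mulrCA. Qed.

Lemma expect_sum (I : finType) (A : pred I) (f : I -> {set T} -> R) :
  expect (fun X => \sum_(i | A i) f i X) = \sum_(i | A i) expect (f i).
Proof.
rewrite /expect exchange_big; apply: eq_bigr => X _.
by rewrite mulr_sumr.
Qed.

Lemma expect1 : expect (fun=> 1) = 1.
Proof.
have := expect_prod (fun=> 1) (fun=> 1).
rewrite (eq_expect (g := fun=> 1)); last by move=> X; rewrite big1 // => t _; case: ifP.
by move=> ->; rewrite big1 // => t _; ring.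
Qed.

Lemma expect_cst a : expect (fun=> a) = a.
Proof.
by rewrite -[RHS]mulr1 -expect1 -expectZ; apply: eq_expect => X; rewrite mulr1.
Qed.

Lemma expect_ge0 f : (forall X, 0 <= f X) -> 0 <= expect f.
Proof. by move=> f0; rewrite -(expect_cst 0); apply: ler_expect. Qed.

Lemma Pr_ge0 P : 0 <= Pr P.
Proof. by apply: expect_ge0 => X; rewrite ler0n. Qed.

Lemma ler_Pr P Q : (forall X, P X -> Q X) -> Pr P <= Pr Q.
Proof.
move=> PQ; apply: ler_expect => X; rewrite ler_nat.
by case: (P X) (PQ X) => [->|].
Qed.

Lemma Pr_split P Q : Pr P = Pr (predI P Q) + Pr (predD P Q).
Proof.
rewrite /Pr -expectD; apply: eq_expect => X /=.
by case: (P X); case: (Q X); rewrite ?addr0 ?add0r.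
Qed.

Lemma Pr_exists (I : finType) (A : pred I) (P : I -> pred {set T}) :
  Pr (fun X => [exists (i | A i), P i X]) <= \sum_(i | A i) Pr (P i).
Proof.
rewrite -expect_sum; apply: ler_expect => X.
case: existsP => [[i /andP[Ai Pi]]|_]; last by apply: sumr_ge0 => i _; rewrite ler0n.
by rewrite (bigD1 i) //= Pi lerDl; apply: sumr_ge0 => j _; rewrite ler0n.
Qed.

Lemma Pr_setI_eq (A B : {set T}) : B \subset A ->
  Pr (fun X => X :&: A == B) = q ^+ #|B| * (1 - q) ^+ #|A :\: B|.
Proof.
move=> BA.
(* The event factorizes over coordinates: a point of X must avoid [A :\: B], a point outside X must
   avoid B. *)
transitivity (expect (fun X => \prod_t
    (if t \in X then (t \notin A :\: B)%:R else (t \notin B)%:R))).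
  apply: eq_expect => X; case: eqP => [XAB|XAB] /=.
    rewrite big1 // => t _; rewrite -XAB !inE.
    by case: (t \in X); case: (t \in A).
  have /existsP[t Ht] : [exists t, (t \in X :&: A) != (t \in B)].
    apply/contraT => /existsPn H; case: XAB; apply/setP => t.
    by move: (H t); rewrite negbK => /eqP.
  rewrite (bigD1 t) //=; move: Ht; rewrite !inE.
  have := subsetP BA t.
  by case: (t \in X); case: (t \in A); case: (t \in B) => //= H; rewrite ?mul0r //; have := H isT.
rewrite expect_prod (bigID (mem B)) /=; congr (_ * _).
  rewrite -prodr_const; apply: eq_bigr => t tB; rewrite !inE tB /=; ring.
rewrite (bigID (mem A)) /= [X in _ * X]big1 ?mulr1; last first.
  by move=> t /andP[/negPf tB /negPf tA]; rewrite !inE tA tB /=; ring.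
rewrite -prodr_const; apply: eq_big => [t|t /andP[/negPf tB tA]]; first by rewrite inE.
by rewrite !inE tA tB /=; ring.
Qed.

(** The conditional expectation of f given all coordinates other than t. *)
Definition average t f X : R := q * f (t |: X) + (1 - q) * f (X :\ t).

Lemma expect_average t f : expect (average t f) = expect f.
Proof.
have wU X : t \notin X -> weight (t |: X) = q * \prod_(u | u != t) (if u \in X then q else 1 - q).
  move=> tX; rewrite /weight (bigD1 t) //= setU11; congr (_ * _).
  by apply: eq_bigr => u ut; rewrite !inE (negPf ut).
have wD X : t \notin X -> weight X = (1 - q) * \prod_(u | u != t) (if u \in X then q else 1 - q).
  by move=> tX; rewrite /weight (bigD1 t) //= (negPf tX).
(* Subsets are paired as X and [t |: X]; averaging preserves the weighted sum over each pair. *)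
have split_t (g : {set T} -> R) : \sum_X g X = \sum_(X : {set T} | t \notin X) (g (t |: X) + g X).
  rewrite (bigID (fun X : {set T} => t \in X)) /= big_split /=; congr (_ + _).
  rewrite (reindex_onto (fun X : {set T} => t |: X) (fun X : {set T} => X :\ t)) /=; last first.
    by move=> X tX; rewrite setD1K.
  apply: eq_bigl => X; rewrite setU11 /=; apply/eqP/idP => [<-|tX]; last by rewrite setU1K.
  by rewrite !inE eqxx.
rewrite /expect !split_t; apply: eq_bigr => X tX.
rewrite /average wU // wD // setU1K // setUA setUid.
by rewrite (setDidPl _) 1?disjoint_sym ?disjoints1 //; ring.
Qed.

(** A positive s means increasing, a negative s decreasing; the sign is a parameter so that one
    induction yields both forms of Harris' inequality. *)
Definition monotone (s : R) f := forall t X, 0 <= s * (f (t |: X) - f (X :\ t)).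
Definition supported D f := forall X, f X = f (X :&: D).

Lemma average_monotone s t f : monotone s f -> monotone s (average t f).
Proof.
case/andP: q01 => q0 q1 mf u X; rewrite /average.
have [->|ut] := eqVneq u t.
  have -> : t |: (t |: X) = t |: X by rewrite setUA setUid.
  have -> : t |: (X :\ t) = t |: X by apply/setP => x; rewrite !inE; case: eqP.
  have -> : (t |: X) :\ t = X :\ t by apply/setP => x; rewrite !inE; case: eqP.
  have -> : X :\ t :\ t = X :\ t by apply/setP => x; rewrite !inE; case: eqP.
  by rewrite subrr mulr0.
have -> : t |: (u |: X) = u |: (t |: X) by rewrite setUCA.
have -> : t |: (X :\ u) = (t |: X) :\ u.
  by apply/setP => x; rewrite !inE; case: eqP => // ->; rewrite eq_sym ut.
have -> : (u |: X) :\ t = u |: (X :\ t).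
  by apply/setP => x; rewrite !inE; case: (x =P u) => // ->; rewrite ut.
have -> : X :\ u :\ t = X :\ t :\ u by rewrite !setDDl setUC.
have -> : s * (q * f (u |: (t |: X)) + (1 - q) * f (u |: X :\ t) -
       (q * f ((t |: X) :\ u) + (1 - q) * f (X :\ t :\ u))) =
  q * (s * (f (u |: (t |: X)) - f ((t |: X) :\ u))) +
  (1 - q) * (s * (f (u |: X :\ t) - f (X :\ t :\ u))) by ring.
by rewrite addr_ge0 // mulr_ge0 ?subr_ge0 //; apply: mf.
Qed.

Lemma average_supported t D f : supported D f -> supported (D :\ t) (average t f).
Proof.
move=> sf X; rewrite /average [f (t |: X)]sf [f (X :\ t)]sf.
rewrite [f (t |: _)]sf [f (_ :\ t)]sf.
congr (q * f _ + _ * f _); apply/setP => x; rewrite !inE; case: eqP => //=.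
all: by case: (x \in X); case: (x \in D).
Qed.

(* Harris' inequality, conditionally on the coordinates outside D, on which h
   depends; induction averages out one coordinate of D at a time. *)
Lemma harris s D f g h : s != 0 -> monotone s f -> monotone (- s) g ->
  supported D f -> supported (~: D) h -> (forall X, 0 <= h X) ->
  expect (fun X => f X * g X * h X) <= expect f * expect (fun X => g X * h X).
Proof.
move=> s0; elim: {D}_.+1 {-2}D (ltnSn #|D|) f g => // n IHn D leDn f g mf mg sf sh h0.
case: (set_0Vmem D) => [D0|[t tD]].
  have fc X : f X = f set0 by rewrite sf D0 setI0.
  rewrite (eq_expect (g := fun X => f set0 * (g X * h X))); last first.
    by move=> X; rewrite (fc X) mulrA.
  by rewrite expectZ (eq_expect fc) expect_cst.
have ht X : h (t |: X) = h (X :\ t).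
  rewrite sh [RHS]sh; congr h; apply/setP => x; rewrite !inE.
  by case: eqP => //= ->; rewrite tD /= ?andbF.
have hX X : h X = h (X :\ t).
  rewrite sh [RHS]sh; congr h; apply/setP => x; rewrite !inE.
  by case: eqP => //= ->; rewrite tD /= ?andbF.
rewrite -(expect_average t f) -(expect_average t (fun X => g X * h X)).
rewrite -(expect_average t (fun X => f X * g X * h X)).
have -> : expect (average t (fun X => g X * h X)) =
          expect (fun X => average t g X * h X).
  by apply: eq_expect => X; rewrite /average ht (hX X); ring.
have lD : (#|D :\ t| < n)%N by rewrite (cardsD1 t) tD in leDn.
apply: le_trans (IHn _ lD _ _ (average_monotone t mf) (average_monotone t mg)
  (average_supported t sf) _ h0); last first.
  move=> X; rewrite sh [RHS]sh; congr h; apply/setP => x; rewrite !inE.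
  by case: (x \in X); case: (x \in D); rewrite ?andbF.
(* What remains is pointwise: for a single coordinate the two sides differ by
   [q * (1 - q) * (f1 - f0) * (g1 - g0) * hx], which is nonpositive as f and g vary in opposite
   directions. *)
apply: ler_expect => X; rewrite /average ht (hX X).
set hx := h _; set f1 := f _; set f0 := f _; set g1 := g _; set g0 := g _.
have hx0 : 0 <= hx by apply: h0.
have fg0 : (f1 - f0) * (g1 - g0) <= 0.
  have s2 : 0 < s ^+ 2 by rewrite exprn_even_gt0.
  have := mulr_ge0 (mf t X) (mg t X); rewrite -/f1 -/f0 -/g1 -/g0.
  have -> : s * (f1 - f0) * (- s * (g1 - g0)) = s ^+ 2 * (- ((f1 - f0) * (g1 - g0))) by ring.
  by rewrite pmulr_rge0 // oppr_ge0.
case/andP: q01 => q0 q1.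
have : 0 <= q * (1 - q) * - ((f1 - f0) * (g1 - g0)) * hx.
  by rewrite !mulr_ge0 ?subr_ge0 ?oppr_ge0.
move=> H; rewrite -subr_ge0; apply: le_trans H _; rewrite le_eqVlt; apply/orP; left.
by apply/eqP; ring.
Qed.

Definition up_event P := forall X Y, X \subset Y -> P X -> P Y.
Definition down_event P := forall X Y, X \subset Y -> P Y -> P X.

Lemma up_event_monotone P : up_event P -> monotone 1 (fun X => (P X)%:R).
Proof.
move=> uP t X; rewrite mul1r subr_ge0 ler_nat.
have /uP : X :\ t \subset t |: X by apply: subset_trans (subsetUr _ _); apply: subD1set.
by case: (P (X :\ t)) => // ->.
Qed.

Lemma down_event_monotone P : down_event P -> monotone (- 1) (fun X => (P X)%:R).
Proof.
move=> dP t X; rewrite mulN1r opprB subr_ge0 ler_nat.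
have /dP : X :\ t \subset t |: X by apply: subset_trans (subsetUr _ _); apply: subD1set.
by case: (P (t |: X)) => // ->.
Qed.

(** Given the coordinates outside D, which decide Q', the increasing P and the decreasing Q are
    negatively correlated, and the conditional probability of P is still [Pr P]. *)
Lemma harris_up D P Q Q' : up_event P -> down_event Q ->
  (forall X, P X = P (X :&: D)) -> (forall X, Q' X = Q' (X :\: D)) ->
  Pr (fun X => [&& P X, Q X & Q' X]) <= Pr P * Pr (predI Q Q').
Proof.
move=> uP dQ sP sQ.
have := @harris 1 D (fun X => (P X)%:R) (fun X => (Q X)%:R) (fun X => (Q' X)%:R).
rewrite oner_eq0 => /(_ isT (up_event_monotone uP) (down_event_monotone dQ)) H.
apply: le_trans (le_trans (H _ _ _) _).
- by apply: ler_expect => X; rewrite -!natrM !mulnb andbA.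
- by move=> X; rewrite -sP.
- by move=> X; rewrite -setDE -sQ.
- by move=> X; rewrite ler0n.
by apply: ler_wpM2l; [apply: Pr_ge0|apply: ler_expect => X; rewrite -natrM mulnb].
Qed.

Lemma harris_down D P Q Q' : down_event P -> up_event Q ->
  (forall X, P X = P (X :&: D)) -> (forall X, Q' X = Q' (X :\: D)) ->
  Pr (fun X => [&& P X, Q X & Q' X]) <= Pr P * Pr (predI Q Q').
Proof.
move=> dP uQ sP sQ.
have := @harris (- 1) D (fun X => (P X)%:R) (fun X => (Q X)%:R) (fun X => (Q' X)%:R).
rewrite oppr_eq0 oner_eq0 opprK.
move=> /(_ isT (down_event_monotone dP) (up_event_monotone uQ)) H.
apply: le_trans (le_trans (H _ _ _) _).
- by apply: ler_expect => X; rewrite -!natrM !mulnb andbA.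
- by move=> X; rewrite -sP.
- by move=> X; rewrite -setDE -sQ.
- by move=> X; rewrite ler0n.
by apply: ler_wpM2l; [apply: Pr_ge0|apply: ler_expect => X; rewrite -natrM mulnb].
Qed.

Lemma Pr_subset S : Pr (fun X => S \subset X) = q ^+ #|S|.
Proof.
rewrite -[RHS]mulr1 -[in RHS](expr0 (1 - q)) -(cards0 T) -(setDv S) -Pr_setI_eq //.
by apply: eq_expect => X; rewrite (sameP setIidPr eqP).
Qed.

End RandomSubset.

(** * A lopsided local lemma *)

(* The events [good v] are increasing and the avoidance
   of the sets of J is decreasing, so by Harris' inequality the only harmful
   correlations are those between a vertex v and the sets of J meeting
   [star v]; in particular distinct vertices do not interact. *)
Section LocalLemma.
Variables (R : realType) (E V : finType) (q : R) (star : V -> {set E}).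
Variables (good : V -> pred {set E}).
Hypothesis q01 : 0 <= q <= 1.
Hypothesis good_up : forall v, up_event (good v).
Hypothesis good_star : forall v X, good v X = good v (X :&: star v).
Implicit Types (S X : {set E}) (J : {set {set E}}) (W : {set V}).

Definition touched S : {set V} := [set v | star v :&: S != set0].
(** The unconditional probability that S is sampled, times the price 5/4 of dropping the goodness
    requirement at each touched vertex. *)
Definition spread_weight S : R := q ^+ #|S| * (5 / 4) ^+ #|touched S|.

Hypothesis good_likely : forall v, Pr q (predC (good v)) <= 1 / 10.

Definition avoids J X := [forall S in J, ~~ (S \subset X)].
Definition all_good W X := [forall v in W, good v X].

(** The bound 1/2 ensures that also avoiding the sets of J that touch v costs at most a factor 2. *)
Definition sparse_family J :=
  forall v, \sum_(S in J | v \in touched S) spread_weight S <= 1 / 2.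

Lemma sparse_familyW J J' : J' \subset J -> sparse_family J -> sparse_family J'.
Proof.
move=> JJ sJ v; apply: le_trans (sJ v); rewrite [leRHS](bigID (mem J')) /=.
rewrite -[leLHS]addr0 lerD //.
  rewrite le_eqVlt; apply/orP; left; apply/eqP; apply: eq_bigl => S.
  by case: (boolP (S \in J')) => [/(subsetP JJ) ->|]; rewrite /= ?andbT ?andbF.
case/andP: q01 => q0 q1; apply: sumr_ge0 => S Sx.
by rewrite mulr_ge0 ?exprn_ge0 ?divr_ge0.
Qed.

Lemma avoids_down J : down_event (avoids J).
Proof.
move=> X Y XY /forall_inP aY; apply/forall_inP => S SJ.
by apply: contra (aY S SJ) => /subset_trans; apply.
Qed.

Lemma all_good_up W : up_event (all_good W).
Proof.
move=> X Y XY /forall_inP gX; apply/forall_inP => v vW.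
exact: good_up XY (gX v vW).
Qed.

Lemma all_goodU1 v W X : all_good (v |: W) X = good v X && all_good W X.
Proof.
apply/forall_inP/andP => [H|[gv /forall_inP H] w].
  split; first by apply: H; rewrite setU11.
  by apply/forall_inP => w wW; apply: H; rewrite inE wW orbT.
by rewrite !inE => /predU1P[-> //|]; apply: H.
Qed.

Lemma all_good_setD W S X :
  all_good (W :\: touched S) X = all_good (W :\: touched S) (X :\: S).
Proof.
apply: eq_forallb => v; rewrite inE; case: (boolP (v \in touched S)) => //=.
rewrite inE negbK => /eqP svS; rewrite good_star [in RHS]good_star.
congr (_ ==> good v _).
apply/setP => x; move/setP/(_ x): svS; rewrite !inE.
by case: (x \in X); case: (x \in S); case: (x \in star v).
Qed.

Definition joint W J := Pr q (predI (all_good W) (avoids J)).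

Lemma joint_ge0 W J : 0 <= joint W J.
Proof. exact: Pr_ge0. Qed.

Section Step.
Variables (n : nat) (J : {set {set E}}).
Hypothesis step : forall W v, (#|W| < n)%N ->
  joint W J <= 5 / 4 * joint (v |: W) J.

(** The vertices of A lying in W are restored one by one, each at the price 5/4 given by [step];
    those outside W cost nothing. *)
Lemma joint_setD W (A : {set V}) : (#|W| <= n)%N ->
  joint (W :\: A) J <= (5 / 4) ^+ #|A| * joint W J.
Proof.
move: {2}#|A| (erefl #|A|) => m; elim: m A W => [|m IHm] A W cA leW.
  by rewrite cA (cards0_eq cA) setD0 expr0 mul1r.
have [v vA] : exists v, v \in A by apply/card_gt0P; rewrite cA.
have cA' : #|A :\ v| = m by move: cA; rewrite (cardsD1 v) vA => -[].
have -> : W :\: A = (W :\ v) :\: (A :\ v).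
  by apply/setP => x; rewrite !inE; case: eqP => [->|] //=; rewrite vA.
have [vW|vW] := boolP (v \in W); last first.
  have -> : W :\ v = W by apply/setDidPl; rewrite disjoint_sym disjoints1.
  apply: le_trans (IHm _ _ cA' leW) _; rewrite cA cA' exprS -mulrA.
  by rewrite ler_peMl ?mulr_ge0 ?exprn_ge0 ?divr_ge0 ?joint_ge0 //; lra.
have ltW : (#|W :\ v| < n)%N by rewrite (cardsD1 v) vW in leW.
apply: le_trans (IHm _ _ cA' (ltnW ltW)) _.
rewrite cA cA' exprSr -mulrA ler_wpM2l ?exprn_ge0 ?divr_ge0 //.
by have := step v ltW; rewrite setD1K.
Qed.

(** Once the touched vertices are dropped from W, goodness does not depend on S. Harris' inequality
    then separates the increasing event [S \subset X] from the decreasing avoidance of J, and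
    [joint_setD] restores the dropped vertices. *)
Lemma spread_step W S : (#|W| <= n)%N ->
  Pr q (fun X => [&& S \subset X, all_good W X & avoids J X]) <=
  spread_weight S * joint W J.
Proof.
move=> leW; rewrite /spread_weight -mulrA.
apply: le_trans (ler_wpM2l _ (joint_setD (touched S) leW)); last first.
  by case/andP: q01 => q0 _; rewrite exprn_ge0.
rewrite -(Pr_subset q S) /joint.
have sub_up : up_event (fun X => S \subset X) by move=> X Y XY SX; apply: subset_trans XY.
have := harris_up q01 (D := S) (Q' := all_good (W :\: touched S)) sub_up (@avoids_down J).
move=> /(_ _ _)/wrap[].
- by move=> X; rewrite subsetI subxx andbT.
- exact: all_good_setD.
move=> H; apply: le_trans (le_trans H _).
  apply: ler_Pr => // X /and3P[SX gX aX]; rewrite /= SX aX /=.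
  by apply/forall_inP => v /setDP[vW _]; move/forall_inP: gX => /(_ v vW).
rewrite le_eqVlt; apply/orP; left; apply/eqP; congr (_ * _).
by apply: eq_expect => X /=; rewrite andbC.
Qed.

End Step.

(** Let J' be the members of J not touching v. By Harris' inequality on [star v], the event that v
    is bad contributes at most [joint W J'] / 10; by the union bound and [spread_step] for smaller
    sets, [joint W J'] is at most twice [joint W J]. So a bad v loses at most 1/5 of [joint W J]. *)
Lemma joint_step n W v J : sparse_family J -> (#|W| < n)%N ->
  joint W J <= 5 / 4 * joint (v |: W) J.
Proof.
elim: n W v J => // n IHn W v J sJ; rewrite ltnS => leW.
pose J' := [set S in J | v \notin touched S].
have J'J : J' \subset J by apply/subsetP => S; rewrite inE => /andP[].
have sJ' := sparse_familyW J'J sJ.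
have low : Pr q (fun X => [&& ~~ good v X, all_good W X & avoids J X]) <=
           1 / 10 * joint W J'.
  have := harris_down q01 (D := star v) (P := predC (good v)) (Q := all_good W) (Q' := avoids J').
  move=> /(_ _ _ _ _)/wrap[].
  - by move=> X Y XY /=; apply: contra; apply: good_up.
  - exact: all_good_up.
  - by move=> X /=; rewrite good_star.
  - move=> X; apply: eq_forallb => S; case: (boolP (S \in J')) => //=.
    rewrite !inE negbK => /andP[_ /eqP svS]; congr (~~ _); rewrite subsetD.
    by rewrite disjoint_sym -setI_eq0 svS eqxx andbT.
  move=> H; apply: le_trans (le_trans H _); last first.
    by apply: ler_wpM2r; [exact: Pr_ge0 | exact: good_likely].
  apply: ler_Pr => // X /and3P[bX gX aX]; rewrite /= bX gX /=.
  apply/forall_inP => S /(subsetP J'J) SJ.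
  by move/forall_inP: aX => /(_ S SJ).
have halve : joint W J' <= 2 * joint W J.
  suff H : joint W J' <= joint W J + 1 / 2 * joint W J'.
    by move: H; lra.
  rewrite [leLHS](Pr_split _ _ (avoids J)) lerD //.
    by apply: ler_Pr => // X /andP[/andP[/= -> _] ->].
  apply: le_trans (ler_wpM2r (joint_ge0 W J') (sJ v)).
  rewrite mulr_suml.
  apply: (@le_trans _ _ (\sum_(S in J | v \in touched S)
     Pr q (fun X => [&& S \subset X, all_good W X & avoids J' X]))).
    apply: le_trans (Pr_exists q01 _ _); apply: ler_Pr => // X /andP[/= naX /andP[gX aX]].
    move: naX; rewrite negb_forall => /existsP[S]; rewrite negb_imply negbK => /andP[SJ SX].
    apply/existsP; exists S; rewrite SJ SX gX aX /= andbT.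
    apply: contraT => vS; move/forall_inP: aX => /(_ S).
    by rewrite inE SJ vS SX => /(_ isT).
  apply: ler_sum => S _; apply: spread_step leW => W' w ltW'.
  exact: IHn.
have jointU : joint W J = joint (v |: W) J +
    Pr q (fun X => [&& ~~ good v X, all_good W X & avoids J X]).
  rewrite [LHS](Pr_split _ _ (good v)); congr (_ + _); apply: eq_expect => X /=.
  by rewrite all_goodU1 andbC andbA.
have := joint_ge0 W J.
by move: jointU low halve; lra.
Qed.

Lemma local_lemma_spread J S : sparse_family J ->
  Pr q (fun X => [&& S \subset X, all_good setT X & avoids J X]) <=
  spread_weight S * joint setT J.
Proof.
move=> sJ; apply: (@spread_step #|V|) => [W v|]; last exact: max_card.
exact: joint_step.
Qed.

(** All vertices are restored at once. The factor obtained is the one that the probability of a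
    global failure has to beat. *)
Lemma local_lemma J : sparse_family J ->
  Pr q (avoids J) <= (5 / 4) ^+ #|V| * joint setT J.
Proof.
move=> sJ; have := @joint_setD #|V| J _ setT setT.
rewrite setDv cardsT => /(_ (fun W v => joint_step v sJ)) H.
apply: le_trans (H (leqnn _)); apply: ler_Pr => // X aX /=.
by rewrite aX andbT; apply/forall_inP => v; rewrite inE.
Qed.

End LocalLemma.

(** * A subgraph with bounded degrees *)

Lemma subset_of_card (T : finType) (A : {set T}) k : (k <= #|A|)%N ->
  exists2 B : {set T}, B \subset A & #|B| = k.
Proof.
move=> kA; exists [set x in take k (enum A)].
  by apply/subsetP => x; rewrite inE => /mem_take; rewrite mem_enum.
by rewrite cardsE (card_uniqP _) ?take_uniq ?enum_uniq // size_takel // -cardE.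
Qed.

Section Adjacency.
Variable V : finType.
Implicit Types (G H F : sgraph V) (A B : {set V}) (v : V).

Lemma edge_card G e : e \in edges G -> #|e| = 2.
Proof. by move=> eG; have /forall_inP/(_ e eG)/eqP := edgesP G. Qed.

Lemma adjC G x y : adj G x y = adj G y x.
Proof. by rewrite /adj setUC. Qed.

Lemma adj_neq G x y : adj G x y -> x != y.
Proof.
by move=> /edge_card; rewrite cards2; case: eqP.
Qed.

Definition nbrs G v : {set V} := [set u | adj G v u].

Lemma edges_betweenE G A B :
  edges_between G A B = (\sum_(a in A) #|nbrs G a :&: B|)%N.
Proof.
rewrite /edges_between -sum1_card.
transitivity (\sum_(a in A) \sum_(b in B | adj G a b) 1)%N.
  by rewrite pair_big_dep; apply: eq_bigl => -[a b]; rewrite !inE andbA.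
apply: eq_bigr => a _; rewrite sum1dep_card; apply: eq_card => b.
by rewrite !inE andbC.
Qed.

Lemma edges_betweenC G A B : edges_between G A B = edges_between G B A.
Proof.
have swapK : involutive (fun ab : V * V => (ab.2, ab.1)) by case.
rewrite /edges_between -(card_imset _ (can_inj swapK)).
apply: eq_card => -[a b]; apply/imsetP/idP => [[[x y]]|].
  by rewrite !inE /= => /andP[/andP[xA yB] xy] [-> ->]; rewrite xA yB adjC.
rewrite !inE /= => /andP[/andP[aB bA] ab]; exists (b, a) => //.
by rewrite !inE /= aB bA adjC.
Qed.

Lemma edges_between_sub H G A B : spanning_subgraph H G ->
  (edges_between H A B <= edges_between G A B)%N.
Proof.
move=> /subsetP HG; apply: subset_leq_card; apply/subsetP => ab.
by rewrite !inE => /andP[-> /HG].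
Qed.

Lemma min_degree_le G v : (min_degree G <= deg G v)%N.
Proof.
rewrite /min_degree; have : v \in index_enum V by rewrite mem_index_enum.
elim: (index_enum V) => // w s IHs; rewrite inE big_cons geq_min.
by case/predU1P => [->|/IHs ->]; rewrite ?leqnn ?orbT.
Qed.

Lemma min_degree_ind G (P : pred nat) : P #|V| -> (forall v, P (deg G v)) ->
  P (min_degree G).
Proof.
move=> PV PG; rewrite /min_degree; elim/big_rec: _ => // v m _ Pm.
by rewrite /minn; case: ifP.
Qed.

Lemma deg_le_max G v : (deg G v <= max_degree G)%N.
Proof. exact: (leq_bigmax v). Qed.

End Adjacency.

Section Regularize.
Variables (R : realType) (V : finType) (p c : R).
Let n : R := #|V|%:R.
Hypotheses (p0 : 0 < p) (c0 : 0 <= c).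

(** The upper half of bijumbledness with error parameter [c * p * n]; unlike the lower half, it
    passes to subgraphs. *)
Definition upper_jumbled (G : sgraph V) := forall A B : {set V},
  (edges_between G A B)%:R <=
  p * #|A|%:R * #|B|%:R + c * p * n * Num.sqrt (#|A|%:R * #|B|%:R).

(* Hall-type selection: hubs A of B receive at most c^2 |B| vertices, hence few
   vertices of B have many hub neighbours; all the others drop their hubs. *)
Lemma bounded_selection (G : sgraph V) (d : R) : upper_jumbled G ->
  2 * c ^+ 2 <= d -> forall B : {set V}, exists S : V -> {set V},
  (forall v, v \in B -> S v \subset nbrs G v /\ #|nbrs G v :\: S v|%:R <= d * p * n)
  /\ forall a, #|[set v in B | a \in S v]|%:R <= 2 * p * n.
Proof.
move=> jG cd B; have [m leB] := ubnP #|B|; elim: m B leB => // m IHm B leB.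
have n0 : 0 <= n by rewrite ler0n.
pose A := [set a | 2 * p * n < #|nbrs G a :&: B|%:R].
pose B' := [set v in B | d * p * n < #|nbrs G v :&: A|%:R].
have [B0|[b bB]] := set_0Vmem B.
  exists (fun=> set0); rewrite B0; split=> [v|a]; first by rewrite inE.
  have -> : [set v : V in set0 | a \in (set0 : {set V})] = set0 by apply/setP => v; rewrite !inE.
  by rewrite cards0 !mulr_ge0 // ltW.
have npos : 0 < n by rewrite ltr0n; apply/card_gt0P; exists b.
(* If B' were all of B, counting the edges between A and B from both sides would give |A| <= c^2 |B|
   ([h4], with x and y the square roots of the sizes) and then d |B| < 2 c^2 |B|, against the choice
   of d. *)
have ltB' : (#|B'| < #|B|)%N.
  rewrite proper_card // properE; apply/andP; split.
    by apply/subsetP => v; rewrite inE => /andP[].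
  apply/negP => /subsetP BB'.
  pose x := Num.sqrt (#|A|%:R : R); pose y := Num.sqrt (#|B|%:R : R).
  have x0 : 0 <= x by apply: sqrtr_ge0.
  have y0 : 0 < y by rewrite sqrtr_gt0 ltr0n; apply/card_gt0P; exists b.
  have x2 : #|A|%:R = x ^+ 2 by rewrite sqr_sqrtr ?ler0n.
  have y2 : #|B|%:R = y ^+ 2 by rewrite sqr_sqrtr ?ler0n.
  have yn : y ^+ 2 <= n by rewrite -y2 ler_nat max_card.
  have jAB := jG A B; rewrite sqrtrM ?ler0n // -/x -/y x2 y2 in jAB.
  have h1 : 2 * p * n * x ^+ 2 <= (edges_between G A B)%:R.
    rewrite edges_betweenE natr_sum -x2 -sum1_card natr_sum mulr_sumr.
    by apply: ler_sum => a; rewrite inE mulr1 => /ltW.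
  have h2 : d * p * n * y ^+ 2 < (edges_between G A B)%:R.
    rewrite edges_betweenC edges_betweenE natr_sum -y2 -sum1_card natr_sum mulr_sumr.
    apply: ltr_sum => [|v vB]; first by apply/hasP; exists b; rewrite ?mem_index_enum.
    by move: (BB' v vB); rewrite inE mulr1 => /andP[].
  have h3 : p * x ^+ 2 * y ^+ 2 <= p * n * x ^+ 2.
    rewrite -subr_ge0.
    have -> : p * n * x ^+ 2 - p * x ^+ 2 * y ^+ 2 = p * x ^+ 2 * (n - y ^+ 2) by ring.
    by rewrite !mulr_ge0 ?sqr_ge0 ?subr_ge0 // ltW.
  have pn : 0 < p * n by rewrite mulr_gt0.
  have h4 : x <= c * y.
    have [->|xn0] := eqVneq x 0; first by rewrite mulr_ge0 // ltW.
    have xp : 0 < x by rewrite lt_neqAle eq_sym xn0.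
    rewrite -(ler_pM2r xp) -(ler_pM2l pn).
    have -> : p * n * (x * x) = p * n * x ^+ 2 by ring.
    have -> : p * n * (c * y * x) = c * p * n * (x * y) by ring.
    by move: h1 jAB h3; lra.
  have h5 : d * y ^+ 2 < x ^+ 2 + c * (x * y).
    rewrite -(ltr_pM2l pn); move: h2 jAB h3.
    have -> : p * n * (d * y ^+ 2) = d * p * n * y ^+ 2 by ring.
    have -> : p * n * (x ^+ 2 + c * (x * y)) = p * n * x ^+ 2 + c * p * n * (x * y) by ring.
    lra.
  have h6 : x ^+ 2 <= c ^+ 2 * y ^+ 2.
    by rewrite -exprMn ler_sqr ?nnegrE ?mulr_ge0 // ltW.
  have h7 : c * (x * y) <= c ^+ 2 * y ^+ 2.
    have -> : c ^+ 2 * y ^+ 2 = c * (c * y * y) by ring.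
    by rewrite ler_wpM2l // ler_wpM2r // ltW.
  have : 2 * c ^+ 2 * y ^+ 2 <= d * y ^+ 2 by apply: ler_wpM2r; rewrite ?sqr_ge0.
  by move: h5 h6 h7; lra.
have [S' [S'sub S'in]] := IHm B' (leq_trans ltB' leB).
(* A hub is selected only by vertices of B', so the induction bounds its load; any other vertex has
   at most [2 * p * n] neighbours in B altogether. *)
exists (fun v => if v \in B' then S' v else nbrs G v :\: A); split=> [v vB|a].
  case: ifP => [/S'sub//|vB']; split; first exact: subsetDl.
  move: vB'; rewrite inE vB /= => /negbT; rewrite -leNgt; apply: le_trans.
  by rewrite setDDr setDv set0U.
have [aA|aA] := boolP (a \in A).
  apply: le_trans (S'in a); rewrite ler_nat subset_leq_card //.
  apply/subsetP => v; rewrite inE [in X in _ -> X]inE.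
  case: (boolP (v \in B')) => [_ /andP[] //|_].
  by rewrite inE aA andbF.
move: aA; rewrite inE -leNgt; apply: le_trans.
rewrite ler_nat subset_leq_card //; apply/subsetP => v; rewrite inE.
case/andP=> vB avS; rewrite in_setI vB andbT [v \in nbrs _ _]inE adjC; move: avS.
case: (boolP (v \in B')) => [vB'|_].
  by have [/subsetP sv _] := S'sub v vB' => /sv; rewrite inE.
by rewrite !inE => /andP[].
Qed.

(** Each vertex keeps exactly k of its selected neighbours, and an edge survives if one of its ends
    keeps it. A degree in H is then at least k, and at most k plus the number of times the vertex is
    selected. *)
Lemma bounded_degree_subgraph (G : sgraph V) (eps : R) : upper_jumbled G ->
  0 < eps < 1 / 2 -> 16 * c ^+ 2 <= eps -> 8 <= eps * (p * n) ->
  (forall v, (1 / 2 + 3 / 4 * eps) * (p * n) <= (deg G v)%:R) ->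
  exists2 H : sgraph V, spanning_subgraph H G &
    forall v, (1 / 2 + eps / 2) * (p * n) <= (deg H v)%:R <= 3 * (p * n).
Proof.
move=> jG /andP[eps0 eps1] ceps pnbig degG.
(* With d = eps/8 at least (1/2 + 5 eps/8) p n neighbours are selected, which is at least t + 1,
   hence at least k, because eps p n >= 8. *)
have cd : 2 * c ^+ 2 <= eps / 8 by lra.
have [S [Ssub Sin]] := bounded_selection jG cd setT.
have pn0 : 0 <= p * n by rewrite mulr_ge0 ?ler0n // ltW.
have pn16 : 16 <= p * n.
  have : eps * (p * n) <= 1 / 2 * (p * n) by rewrite ler_wpM2r // ltW.
  lra.
set t := (1 / 2 + eps / 2) * (p * n).
pose k := (Num.trunc t).+1.
have t0 : 0 <= t by rewrite mulr_ge0 //; lra.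
have /andP[kt tk] := truncn_itv t0.
have kt' : k%:R <= t + 1 by rewrite /k -addn1 natrD lerD2r.
have kS v : (k <= #|S v|)%N.
  have [Sv Dv] := Ssub v (in_setT v).
  rewrite -(ler_nat R); apply: le_trans kt' _.
  have := degG v; rewrite /deg -[#|[set _ | _]|](cardsID (S v)) natrD (setIidPr Sv).
  by rewrite /t; move: Dv pnbig; rewrite /nbrs; lra.
have S'ex v : {S' : {set V} | (S' \subset S v) && (#|S'| == k)}.
  by apply: sigW; have [B BS Bk] := subset_of_card (kS v); exists B; rewrite BS Bk eqxx.
pose S' v := sval (S'ex v).
have S'S v : S' v \subset S v by have /andP[] := svalP (S'ex v).
have S'k v : #|S' v| = k by have /andP[_ /eqP] := svalP (S'ex v).
pose sel e := [exists v, [exists u in S' v, e == [set v; u]]].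
have HP : [forall e in [set e in edges G | sel e], #|e| == 2].
  by apply/forall_inP => e; rewrite inE => /andP[/edge_card -> _].
have S'adj v u : u \in S' v -> adj G v u.
  have [Sv _] := Ssub v (in_setT v).
  by move/(subsetP (S'S v))/(subsetP Sv); rewrite inE.
have adjH v u : adj (SGraph HP) v u = (u \in S' v) || (v \in S' u).
  rewrite /adj inE; apply/andP/orP => [[vu /existsP[w /existsP[x /andP[xw /eqP vuwx]]]]|].
    have wx := adj_neq (S'adj _ _ xw); have vnu := adj_neq vu.
    have : v \in [set w; x] by rewrite -vuwx !inE eqxx.
    have : u \in [set w; x] by rewrite -vuwx !inE eqxx orbT.
    rewrite !inE => /orP[] /eqP eu /orP[] /eqP ev; move: vnu; rewrite eu ev ?eqxx // => _.
      by right.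
    by left.
  have ex a b : b \in S' a -> sel [set a; b].
    by move=> ba; apply/existsP; exists a; apply/existsP; exists b; rewrite ba eqxx.
  case=> [uv|vu]; first by split; [exact: S'adj | exact: ex].
  by rewrite setUC; split; [exact: S'adj | exact: ex].
exists (SGraph HP); first by apply/subsetP => e; rewrite inE => /andP[].
move=> v; apply/andP; split.
  apply: le_trans (ltW tk) _; rewrite ler_nat -/k -(S'k v) subset_leq_card //.
  by apply/subsetP => u uv; rewrite inE adjH uv.
apply: (@le_trans _ _ (k%:R + 2 * p * n)); last first.
  have : t <= 3 / 4 * (p * n) by rewrite ler_wpM2r //; lra.
  by move: kt' pn16; lra.
apply: le_trans (lerD (lexx _) (Sin v)); rewrite -natrD ler_nat -(S'k v).
apply: leq_trans (leq_card_setU _ _); apply: subset_leq_card; apply/subsetP => u.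
rewrite !inE adjH => /orP[-> //|/(subsetP (S'S u)) ->]; by rewrite orbT.
Qed.

End Regularize.

(** * Trees in dense graphs *)

Section Trees.
Variable V : finType.
Implicit Types (A C Z e : {set V}) (T F E X : {set {set V}}) (v : V).

Definition crossing A e := (A :&: e != set0) && ~~ (e \subset A).

(* Connectivity is expressed by cuts; as cover T has one more element than T,
   the edges of T form a tree. *)
Definition is_tree T :=
  (#|cover T| == #|T|.+1) &&
  [forall A : {set V}, crossing A (cover T) ==> [exists e in T, crossing A e]].

Definition inside F Z := [set e in F | e \subset Z].
Definition incident F Z := [set e in F | Z :&: e != set0].

Lemma tree_cross T A : is_tree T -> crossing A (cover T) ->
  exists2 e, e \in T & crossing A e.
Proof. by case/andP => _ /forallP/(_ A)/implyP H /H/exists_inP. Qed.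

Lemma card_tree T : is_tree T -> #|cover T| = #|T|.+1.
Proof. by case/andP => /eqP. Qed.

Lemma sub_cover T e : e \in T -> e \subset cover T.
Proof. exact: (bigcup_sup e). Qed.

(** An edge of T' that meets [cover T] is in F and incident, hence in T and inside [cover T]. So no
    edge of T' leaves [cover T], and connectivity keeps T' there. *)
Lemma tree_incident_sub T T' F v : is_tree T' ->
  v \in cover T -> v \in cover T' -> {in T', forall e, e != set0} ->
  T' \subset F -> incident F (cover T) \subset T -> T' \subset T.
Proof.
move=> tT' vT vT' T'n T'F FT.
have inT e : e \in T' -> cover T :&: e != set0 -> e \in T.
  by move=> eT' eC; apply: (subsetP FT); rewrite inE eC (subsetP T'F).
have CC : cover T' \subset cover T.
  apply: contraT => nsub; have [|e eT' /andP[eC]] := tree_cross (A := cover T) tT'.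
    by rewrite /crossing nsub andbT; apply/set0Pn; exists v; rewrite inE vT.
  by rewrite sub_cover // inT.
apply/subsetP => e eT'; apply: inT => //.
by rewrite (setIidPr (subset_trans (sub_cover eT') CC)) T'n.
Qed.

(** In percolation on E with edge probability y, the summand is the probability that T is exactly
    the set of open edges meeting [cover T]. Two such trees through v contain each other by
    [tree_incident_sub], so each outcome X is counted at most once. *)
Lemma tree_sum (R : realType) (y : R) E v : 0 <= y <= 1 ->
  {in E, forall e, #|e| = 2} ->
  \sum_(T | [&& is_tree T, T \subset E & v \in cover T])
     y ^+ #|T| * (1 - y) ^+ #|incident E (cover T) :\: T| <= 1.
Proof.
move=> y01 E2.
have En e : e \in E -> e != set0 by move/E2 => e2; rewrite -card_gt0 e2.
rewrite -[leRHS](@expect1 R {set V} y).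
apply: (@le_trans _ _ (expect y (fun X =>
  \sum_(T | [&& is_tree T, T \subset E & v \in cover T])
     (X :&: incident E (cover T) == T)%:R))).
  rewrite expect_sum; apply: ler_sum => T /and3P[tT TE vT].
  rewrite -Pr_setI_eq //; apply/subsetP => e eT; rewrite inE (subsetP TE) //=.
  by rewrite (setIidPr (sub_cover eT)) En // (subsetP TE).
apply: ler_expect => // X.
pose P T := [&& is_tree T, T \subset E & v \in cover T] && (X :&: incident E (cover T) == T).
have uniqP T T' : P T -> P T' -> T' \subset T.
  case/andP=> /and3P[tT TE vT] /eqP XT /andP[/and3P[tT' T'E vT'] /eqP XT'].
  apply: (@tree_incident_sub T T' (X :&: E) v) => //.
  - by move=> e /(subsetP T'E)/En.
  - by rewrite subsetI T'E andbT -XT' subsetIl.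
  have : incident (X :&: E) (cover T) \subset X :&: incident E (cover T).
    by apply/subsetP => e; rewrite !inE -andbA.
  by rewrite XT.
under eq_bigr do rewrite mulrb.
rewrite -big_mkcondr /=; case: (pickP P) => [T PT|noP]; last first.
  by rewrite big_pred0 // ler01.
rewrite (big_pred1 T) // => T' /=; apply/idP/eqP => [PT'|-> //].
by apply/eqP; rewrite eqEsubset !uniqP.
Qed.

Lemma cover_setU1 e T : cover (e |: T) = e :|: cover T.
Proof. by rewrite /cover bigcup_setU big_set1. Qed.

Lemma tree1 e : #|e| = 2 -> is_tree [set e].
Proof.
move=> e2; rewrite /is_tree cover1 e2 cards1 eqxx /=.
by apply/forallP => A; apply/implyP => Ae; apply/exists_inP; exists e; rewrite ?inE.
Qed.

Lemma tree_grow T e : is_tree T -> #|e| = 2 -> crossing (cover T) e ->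
  is_tree (e |: T).
Proof.
move=> tT e2 /andP[/set0Pn[x /setIP[xC xe]] /subsetPn[z ze zC]].
have exz : e = [set x; z].
  apply/esym/eqP; rewrite eqEcard subUset !sub1set xe ze e2 cards2 /=.
  by case: eqP zC => // <-; rewrite xC.
have Ce : cover (e |: T) = z |: cover T.
  rewrite cover_setU1 exz -setUA setUCA; congr (_ |: _).
  by apply/setUidPr; rewrite sub1set.
have eT : e \notin T by apply/negP => /sub_cover/subsetP/(_ z ze); apply/negP.
apply/andP; split; first by rewrite Ce cardsU1 zC cardsU1 eT (card_tree tT).
apply/forallP => A; apply/implyP; rewrite {}Ce => /andP[AC nCA]; apply/exists_inP.
have cT : crossing A (cover T) -> exists2 f, f \in e |: T & crossing A f.
  by move/(tree_cross tT) => [f fT Af]; exists f; rewrite // inE fT orbT.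
(* A cut that splits [cover T] is crossed by T; if A contains [cover T] or is disjoint from it, the
   new edge crosses instead. *)
have [CA|CA] := boolP (cover T \subset A).
  exists e; rewrite ?setU11 // /crossing; apply/andP; split.
    by apply/set0Pn; exists x; rewrite inE xe (subsetP CA).
  apply: contra nCA => eA; rewrite subUset CA andbT sub1set.
  exact: (subsetP eA).
have [AC0|AC0] := eqVneq (A :&: cover T) set0; last by apply: cT; rewrite /crossing AC0.
have xA : x \notin A by apply/negP => xA; have := in_set0 x; rewrite -AC0 inE xA xC.
exists e; rewrite ?setU11 //; apply/andP; split; last by apply/subsetPn; exists x.
case/set0Pn: AC => w /setIP[wA /setU1P[wz|wC]].
  by apply/set0Pn; exists z; rewrite inE ze -wz wA.
by have := in_set0 w; rewrite -AC0 inE wA wC.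
Qed.

Lemma maximal_tree F e0 : {in F, forall e, #|e| = 2} -> e0 \in F ->
  exists T, [/\ is_tree T, T \subset F &
    {in F, forall e, cover T :&: e != set0 -> e \subset cover T}].
Proof.
move=> F2 e0F.
pose P T := is_tree T && (T \subset F).
have P0 : P [set e0] by rewrite /P tree1 ?F2 // sub1set.
case: (arg_maxnP (fun T => #|T|) P0) => T /andP[tT TF] maxT.
exists T; split=> // e eF eC; apply: contraT => neC.
have cTe : crossing (cover T) e by rewrite /crossing eC.
have /maxT : P (e |: T) by rewrite /P tree_grow ?F2 // subUset sub1set eF.
rewrite cardsU1; case: (boolP (e \in T)) => [/sub_cover|_]; first by rewrite (negPf neC).
by rewrite /= add1n ltnn.
Qed.

(** A maximal tree T inside Z spans a component, so the edges inside Z split between [cover T] and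
    its complement in Z. Either [cover T] is dense itself, or the complement is still dense and the
    induction applies there. *)
Lemma dense_tree F L Z : {in F, forall e, #|e| = 2} -> Z != set0 ->
  (L.+1 * #|Z| <= #|inside F Z|)%N ->
  exists T, [/\ is_tree T, T \subset F, cover T \subset Z &
    (L * #|cover T| + #|T| <= #|inside F (cover T)|)%N].
Proof.
move=> F2; have [m leZ] := ubnP #|Z|; elim: m Z leZ => // m IHm Z leZ Z0 dZ.
have [e0 e0Z] : exists e, e \in inside F Z.
  by apply/card_gt0P; apply: leq_trans dZ; rewrite muln_gt0 card_gt0.
have Z2 : {in inside F Z, forall e, #|e| = 2} by move=> e /setIdP[/F2].
have [T [tT TZ closedT]] := maximal_tree Z2 e0Z.
have TF : T \subset F by apply: subset_trans TZ _; apply/subsetP => e /setIdP[].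
have CZ : cover T \subset Z.
  by apply/bigcupsP => e /(subsetP TZ); rewrite inE => /andP[].
have [dC|dC] := leqP (L.+1 * #|cover T|) #|inside F (cover T)|.
  exists T; split=> //; apply: leq_trans dC.
  by rewrite mulSn addnC leq_add2r (card_tree tT).
have splitZ : (#|inside F Z| <= #|inside F (cover T)| + #|inside F (Z :\: cover T)|)%N.
  apply: leq_trans (leq_card_setU _ _); apply: subset_leq_card; apply/subsetP => e eZ.
  have /setIdP[eF eZ'] := eZ; rewrite !inE eF /=.
  have [/eqP eC|/(closedT e eZ) -> //] := boolP (cover T :&: e == set0).
  by rewrite subsetD eZ' disjoint_sym -setI_eq0 eC eqxx orbT.
have cZ : #|Z| = (#|cover T| + #|Z :\: cover T|)%N.
  by rewrite -(cardsID (cover T) Z) (setIidPr CZ).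
have lt0 : (L.+1 * #|Z :\: cover T| < #|inside F (Z :\: cover T)|)%N.
  by rewrite -(ltn_add2l (L.+1 * #|cover T|)) -mulnDr -cZ (leq_ltn_trans dZ) //
     (leq_ltn_trans splitZ) // ltn_add2r.
have [||T' [? ? CZ' ?]] := IHm (Z :\: cover T) _ _ (ltnW lt0).
- by rewrite ltnS in leZ; apply: leq_trans leZ; rewrite cZ (card_tree tT) addSn ltnS leq_addl.
- apply/eqP => ZC0; move: lt0; rewrite ZC0 cards0 muln0.
  case/card_gt0P => e /setIdP[/F2 e2]; rewrite subset0 => /eqP ee.
  by move: e2; rewrite ee cards0.
by exists T'; split=> //; apply: subset_trans CZ' (subsetDl _ _).
Qed.

End Trees.

(** * Edge counts and Chernoff bounds *)

Section Chernoff.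
Variables (R : realType) (E : finType) (q : R).
Hypothesis q01 : 0 <= q <= 1.

Lemma expR_le_inv (x : R) : x < 1 -> expR x <= (1 - x)^-1.
Proof.
move=> x1; rewrite -[x in expR x]opprK expRN lef_pV2 ?posrE ?expR_gt0 ?subr_gt0 //.
exact: expR_ge1Dx.
Qed.

(** Exponential Markov inequality: the indicator is at most the exponential of the excess of the sum
    over s, whose expectation factorizes, and a factor 1 + q u is at most exp (q u). *)
Lemma chernoff (A : {set E}) (w u : E -> R) (s : R) :
  {in A, forall e, expR (w e) <= 1 + u e} ->
  Pr q (fun X => s <= \sum_(e in A :&: X) w e) <= expR (q * (\sum_(e in A) u e) - s).
Proof.
move=> wu; have /andP[q0 q1] := q01.
rewrite expRD mulrC.
apply: (@le_trans _ _ (expect q (fun X => expR (- s) *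
   \prod_e (if e \in X then (if e \in A then expR (w e) else 1) else 1)))).
  apply: ler_expect => // X.
  have -> : \prod_e (if e \in X then (if e \in A then expR (w e) else 1) else 1) =
            expR (\sum_(e in A :&: X) w e).
    rewrite expR_sum [RHS]big_mkcond /=; apply: eq_bigr => e _; rewrite inE.
    by case: (e \in X); case: (e \in A).
  rewrite -expRD.
  case: (boolP (s <= _)) => [sX|_]; last exact: expR_ge0.
  by apply: le_trans (expR_ge1Dx _); rewrite lerDl addrC subr_ge0.
rewrite expectZ ler_wpM2l ?expR_ge0 // expect_prod mulr_sumr expR_sum.
rewrite [leRHS]big_mkcond /=; apply: ler_prod => e _; case: ifP => eA.
  rewrite addr_ge0 ?mulr_ge0 ?expR_ge0 ?subr_ge0 //=.
  apply: le_trans (expR_ge1Dx _).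
  have -> : 1 + q * u e = q * (1 + u e) + (1 - q) * 1 by ring.
  by rewrite lerD2r ler_wpM2l // wu.
by rewrite !mulr1 addrC subrK ler01 lexx.
Qed.

End Chernoff.

Section EdgeCounts.
Variable V : finType.
Implicit Types (G H F : sgraph V) (A B Z e : {set V}) (X : {set {set V}}) (v : V).

Lemma restrictP H X : [forall e in edges H :&: X, #|e| == 2].
Proof. by apply/forall_inP => e /setIP[/edge_card -> _]. Qed.

Definition restrict H X := SGraph (restrictP H X).

Definition star H v : {set {set V}} := [set e in edges H | v \in e].

Lemma deg_star G v : deg G v = #|star G v|.
Proof.
rewrite /deg -(@card_in_imset _ _ (fun u => [set v; u])); last first.
  move=> x y; rewrite !inE => /adj_neq vx /adj_neq vy /setP/(_ x).
  by rewrite !inE eqxx orbT eq_sym (negPf vx) /= => /esym/eqP.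
apply: eq_card => e; rewrite [RHS]inE; apply/imsetP/andP => [[u]|[eG ve]].
  by rewrite inE => vu ->; rewrite !inE eqxx; split.
have := edge_card eG; rewrite (cardsD1 v) ve add1n => -[/eqP/cards1P[u eu]].
have -> : e = [set v; u] by rewrite -(setD1K ve) eu.
by exists u; rewrite // inE /adj -eu setD1K.
Qed.

(** The number of orientations of e lying in A x B. It turns [edges_between] into a weighted sum
    over independent edges. *)
Definition mult A B e := #|[set ab in setX A B | [set ab.1; ab.2] == e]|.

Lemma edges_between_mult G A B :
  edges_between G A B = (\sum_(e in edges G) mult A B e)%N.
Proof.
rewrite /edges_between -sum1_card.
rewrite (partition_big (fun ab => [set ab.1; ab.2]) (mem (edges G))) /=; last first.
  by move=> ab; rewrite inE => /andP[].
apply: eq_bigr => e eG; rewrite /mult -sum1_card; apply: eq_bigl => ab.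
rewrite !inE; case: eqP => [abe|_]; rewrite ?andbF // !andbT /adj abe.
by move: eG => /= ->; rewrite andbT.
Qed.

Lemma mult_le2 A B e : #|e| = 2 -> (mult A B e <= 2)%N.
Proof.
move=> /eqP/cards2P[x [y [xy ->]]].
apply: (@leq_trans #|[set (x, y); (y, x)]|); last by rewrite cards2; case: eqP.
apply: subset_leq_card; apply/subsetP => -[a b]; rewrite !inE /= !xpair_eqE.
case/andP=> _ /eqP abxy.
have : a \in [set x; y] by rewrite -abxy !inE eqxx.
have : b \in [set x; y] by rewrite -abxy !inE eqxx orbT.
have /eqP : #|[set a; b]| = #|[set x; y]| by rewrite abxy.
rewrite !cards2 xy !inE => ab /orP[] /eqP bE /orP[] /eqP aE; move: ab.
all: by rewrite aE bE !eqxx ?orbT.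
Qed.

Lemma mult_inside Z e : #|e| = 2 -> mult Z Z e = (if e \subset Z then 2 else 0)%N.
Proof.
move=> e2; case: ifPn => [eZ|neZ].
  apply/eqP; rewrite eqn_leq mult_le2 //=.
  have /cards2P[x [y [xy exy]]] : #|e| == 2 by rewrite e2.
  apply: (@leq_trans #|[set (x, y); (y, x)]|).
    by rewrite cards2 xpair_eqE (negPf xy).
  have xZ : x \in Z by apply: (subsetP eZ); rewrite exy !inE eqxx.
  have yZ : y \in Z by apply: (subsetP eZ); rewrite exy !inE eqxx orbT.
  apply: subset_leq_card; apply/subsetP => -[a b]; rewrite !inE !xpair_eqE.
  case/orP => /andP[/eqP-> /eqP->] /=; rewrite xZ yZ exy ?eqxx //.
  by rewrite setUC eqxx.
apply: eq_card0 => -[a b]; rewrite !inE /=; apply: contraNF neZ.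
by case/andP => /andP[aZ bZ] /eqP<-; rewrite subUset !sub1set aZ.
Qed.

Lemma edges_between_inside G Z : edges_between G Z Z = (2 * #|inside (edges G) Z|)%N.
Proof.
rewrite edges_between_mult (eq_bigr (fun e => if e \subset Z then 2 else 0)%N); last first.
  by move=> e eG; apply: mult_inside (edge_card eG).
rewrite -big_mkcondr sum_nat_const mulnC; congr (_ * _)%N.
by apply: eq_card => e; rewrite !inE.
Qed.

Lemma edges_between_mono G A B A' B' : A \subset A' -> B \subset B' ->
  (edges_between G A B <= edges_between G A' B')%N.
Proof.
move=> /subsetP AA /subsetP BB; apply: subset_leq_card; apply/subsetP => ab.
by rewrite !inE => /andP[/andP[/AA -> /BB ->]].
Qed.

Variables (R : realType) (q : R).
Hypothesis q01 : 0 <= q <= 1.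

(** Each ordered pair carries weight h. An edge has at most two orientations, and exp (m h) <= 1 + m
    h / (1 - 2 h) for m = 0, 1, 2. *)
Lemma chernoff_upper H A B (h t : R) : 0 <= h < 1 / 2 ->
  Pr q (fun X => t <= (edges_between (restrict H X) A B)%:R) <=
  expR (q * (edges_between H A B)%:R * (h / (1 - 2 * h)) - h * t).
Proof.
move=> /andP[h0 h1]; have h2 : 0 < 1 - 2 * h by lra.
have := @chernoff R _ q q01 (edges H) (fun e => h * (mult A B e)%:R)
  (fun e => (mult A B e)%:R * (h / (1 - 2 * h))) (h * t).
move=> H1; apply: le_trans (le_trans (H1 _) _).
- apply: ler_Pr => // X; rewrite edges_between_mult natr_sum -mulr_sumr.
  by move=> tX; apply: ler_wpM2l.
- move=> e /edge_card/(mult_le2 A B); case: (mult A B e) => [|[|[|//]]] _.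
  + by rewrite mulr0 expR0 mul0r addr0.
  + rewrite mulr1 mul1r; apply: le_trans (expR_le_inv _) _; first lra.
    rewrite -div1r ler_pdivrMr; last lra.
    have -> : (1 + h / (1 - 2 * h)) * (1 - h) = 1 + h ^+ 2 / (1 - 2 * h) by field; lra.
    by rewrite lerDl divr_ge0 ?sqr_ge0 // ltW.
  apply: le_trans (expR_le_inv _) _; first lra.
  by rewrite le_eqVlt; apply/orP; left; apply/eqP; field; lra.
by rewrite -mulr_suml -natr_sum -edges_between_mult mulrA.
Qed.

Lemma chernoff_lower H v (h t : R) : 0 <= h ->
  Pr q (fun X => (deg (restrict H X) v)%:R < t) <=
  expR (h * t - q * (deg H v)%:R * (h / (1 + h))).
Proof.
move=> h0.
have := @chernoff R _ q q01 (star H v) (fun e => - h) (fun e => - (h / (1 + h))) (- (h * t)).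
move=> H1; apply: le_trans (le_trans (H1 _) _).
- apply: ler_Pr => // X; rewrite deg_star sumr_const.
  have -> : star (restrict H X) v = star H v :&: X.
    by apply/setP => e; rewrite !inE andbAC.
  by move=> /ltW tX; rewrite mulNrn lerN2 -mulr_natr; apply: ler_wpM2l.
- move=> e _; apply: le_trans (expR_le_inv _) _; first lra.
  by rewrite le_eqVlt; apply/orP; left; apply/eqP; field; lra.
by rewrite sumr_const -deg_star ler_expR -mulr_natr le_eqVlt; apply/orP; left; apply/eqP; ring.
Qed.

End EdgeCounts.

(** * Weights of the forbidden edge sets *)

Lemma sum_le_reindex (R : realType) (I T : finType) (A : pred T) (P : pred I)
    (g : I -> T) (w : T -> R) : (forall S, 0 <= w S) ->
  (forall S, A S -> exists2 i, P i & g i = S) ->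
  \sum_(S | A S) w S <= \sum_(i | P i) w (g i).
Proof.
move=> w0 PA; rewrite [leRHS](bigID (fun i => A (g i))) /=.
rewrite -[leLHS]addr0 lerD ?sumr_ge0 //.
rewrite (partition_big g A) /=; last by move=> i /andP[].
apply: ler_sum => S AS; have [i Pi giS] := PA S AS.
rewrite (bigD1 i) /=; last by rewrite Pi giS AS eqxx.
by rewrite giS lerDl sumr_ge0.
Qed.

Lemma bernoulli (R : realType) (y : R) k : 0 <= y <= 1 -> 1 - k%:R * y <= (1 - y) ^+ k.
Proof.
move=> /andP[y0 y1]; elim: k => [|k IHk]; first by rewrite mul0r subr0 expr0.
rewrite exprS; apply: le_trans (ler_wpM2l _ IHk); last by rewrite subr_ge0.
rewrite -natr1 -subr_ge0.
have -> : (1 - y) * (1 - k%:R * y) - (1 - (k%:R + 1) * y) = k%:R * y ^+ 2 by ring.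
by rewrite mulr_ge0 ?sqr_ge0.
Qed.

(** A division-free form of C(N, m) <= (4 N / m)^m, obtained from m^m <= C(2m, m) m! <= 4^m m!. *)
Lemma bin_mul_expn N m : ('C(N, m) * m ^ m <= (4 * N) ^ m)%N.
Proof.
have ffact_ge a k : (a ^ k <= (a + k) ^_ k)%N.
  elim: k => [|k IHk]; first by rewrite ffactn0 expn0.
  by rewrite addnS ffactSS expnS leq_mul // leqW // leq_addr.
have ffact_le k : (N ^_ k <= N ^ k)%N.
  by elim: k => [|k IHk]; rewrite ?ffactn0 // ffactnSr expnSr leq_mul // leq_subr.
have bin_le : ('C(m + m, m) <= 4 ^ m)%N.
  rewrite -[X in 'C(X, _)]card_ord -card_draws; apply: leq_trans (max_card _) _.
  by rewrite -cardsT -powersetT card_powerset cardsT card_ord addnn -mul2n expnM.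
have mm : (m ^ m <= 4 ^ m * m`!)%N.
  by apply: leq_trans (ffact_ge m m) _; rewrite -bin_ffact leq_mul2r bin_le orbT.
apply: leq_trans (leq_mul (leqnn _) mm) _.
by rewrite mulnCA bin_ffact expnMn leq_mul2l ffact_le orbT.
Qed.

Lemma small_base (R : realType) (K A : R) : 0 <= A -> 1 <= K -> 60 * K * A <= 1 ->
  5 / 4 * (6 * K) * A <= 2^-1 /\ 5 / 4 * A <= 1 / 8.
Proof.
move=> A0 K1 KA; have AKA : A <= K * A by rewrite ler_peMl.
by split; lra.
Qed.

Section BadFamily.
Variables (R : realType) (V : finType) (H : sgraph V).
Implicit Types (S T X : {set {set V}}) (v : V) (e Z : {set V}).

Lemma touched_sub_cover S : touched (star H) S \subset cover S.
Proof.
apply/subsetP => v; rewrite inE => /set0Pn[e /setIP[/setIdP[_ ve] eS]].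
exact: (subsetP (sub_cover eS)).
Qed.

Lemma card_cover_le S : {in S, forall e, #|e| = 2} -> (#|cover S| <= 2 * #|S|)%N.
Proof.
move=> S2; apply: leq_trans (leq_card_cover S) _.
by rewrite (eq_bigr (fun=> 2%N)) // sum_nat_const mulnC.
Qed.

Definition dense_pair (k : R) (L : nat) T S := [&& is_tree T, T \subset edges H,
  #|cover T|%:R <= k, S \subset inside (edges H) (cover T) :\: T &
  #|S| == (L * #|cover T|)%N].

Definition dense_family k L : {set {set {set V}}} :=
  [set T :|: S | T in [set: {set {set V}}], S in [set S | dense_pair k L T S]].

Variables (p q c k n : R) (K L : nat).
Hypothesis nE : n = #|V|%:R.
Hypothesis qE : q = K%:R / (p * n).
Hypotheses (p0 : 0 < p) (pn1 : 1 <= p * n) (K0 : (0 < K)%N) (L0 : (0 < L)%N).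
Hypothesis jumbledH : upper_jumbled p c H.
Hypothesis degH : forall v, (deg H v)%:R <= 3 * (p * n).
Hypotheses (ck : c <= k) (kK : 16 * k * K%:R <= L%:R).
Hypothesis KL : 60 * K%:R <= 4 ^+ L :> R.

Lemma inside_bound Z : #|Z|%:R <= k * n -> #|inside (edges H) Z|%:R <= k * (p * n) * #|Z|%:R.
Proof.
move=> Zk; have := jumbledH Z Z; rewrite edges_between_inside natrM.
rewrite -expr2 sqrtr_sqr ger0_norm ?ler0n //.
have h1 : p * #|Z|%:R * #|Z|%:R <= k * (p * n) * #|Z|%:R.
  have -> : k * (p * n) * #|Z|%:R = p * (k * n) * #|Z|%:R by ring.
  by rewrite ler_wpM2r // ler_wpM2l // ltW.
have h2 : c * p * n * #|Z|%:R <= k * (p * n) * #|Z|%:R.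
  by rewrite -mulrA -!mulrA ler_wpM2r // !mulr_ge0 ?ler0n ?nE // ltW.
rewrite -nE; lra.
Qed.

(** With m = L z there are at most (4 N / m)^m choices of S, where N <= k p n z by [inside_bound].
    As q = K / (p n), the base is at most 4 k K / L, hence at most 1/4. *)
Lemma count_extensions T : is_tree T -> #|cover T|%:R <= k * n ->
  #|[set S | dense_pair (k * n) L T S]|%:R * q ^+ (L * #|cover T|) <=
    4^-1 ^+ (L * #|cover T|).
Proof.
move=> tT Tk; set z := #|cover T|.
have z0 : (0 < z)%N by rewrite /z (card_tree tT).
set m := (L * z)%N; have m0 : (0 < m)%N by rewrite muln_gt0 L0.
set N := #|inside (edges H) (cover T)|.
have pn0 : 0 < p * n by apply: lt_le_trans pn1.
have q0 : 0 <= q by rewrite qE divr_ge0 // ltW.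
have cN : (#|[set S | dense_pair (k * n) L T S]| * m ^ m <= (4 * N) ^ m)%N.
  apply: leq_trans (bin_mul_expn N m); rewrite leq_mul2r; apply/orP; right.
  rewrite -(cards_draws (inside (edges H) (cover T)) m).
  apply: subset_leq_card; apply/subsetP => S; rewrite !inE.
  by case/and5P => _ _ _ /subset_trans -> // ; rewrite subsetDl.
have mm : 0 < (m%:R : R) ^+ m by rewrite exprn_gt0 // ltr0n.
rewrite -(ler_pM2r mm) mulrAC.
apply: (@le_trans _ _ (((4 * N) ^ m)%:R * q ^+ m)).
  by rewrite -natrX -natrM ler_wpM2r ?exprn_ge0 // ler_nat.
rewrite natrX -!exprMn lerXn2r ?nnegrE ?mulr_ge0 ?invr_ge0 ?ler0n ?(ltW pn0) //.
have := inside_bound Tk; rewrite -/N -/z => Nk.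
rewrite natrM qE mulrA ler_pdivrMr // /m natrM.
have Nk' : N%:R * (16 * K%:R) <= L%:R * z%:R * (p * n).
  apply: le_trans (_ : _ <= 16 * k * K%:R * (p * n) * z%:R) _.
    apply: le_trans (ler_wpM2r _ Nk) _; rewrite ?mulr_ge0 //.
    by rewrite le_eqVlt; apply/orP; left; apply/eqP; ring.
  by rewrite mulrAC !ler_wpM2r // ltW.
rewrite -mulrA -(ler_pM2l (ltr0n R 4)) !mulrA mulfV ?pnatr_eq0 // mul1r.
rewrite -[leRHS]mulrA; apply: le_trans Nk'; rewrite le_eqVlt; apply/orP; left; apply/eqP; ring.
Qed.

Lemma card_incident Z : (#|incident (edges H) Z| <= max_degree H * #|Z|)%N.
Proof.
apply: (@leq_trans (\sum_(v in Z) #|star H v|)); last first.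
  rewrite mulnC -sum_nat_const leq_sum // => v _.
  by rewrite -deg_star deg_le_max.
rewrite (eq_bigr (fun v => \sum_(e in star H v) 1)%N); last by move=> v _; rewrite sum1_card.
rewrite (exchange_big_dep (mem (edges H))) /=; last by move=> v e _ /setIdP[].
rewrite -sum1_card big_mkcond /= [leqRHS]big_mkcond /=.
apply: leq_sum => e _; rewrite inE; case: (boolP (e \in edges H)) => //= eH.
case: set0Pn => // -[v /setIP[vZ ve]].
by rewrite (bigD1 v) //= inE eH vZ ve.
Qed.

(** After summing over S, the sum over T is compared with [tree_sum] at y = 1 / (6 p n), so that q =
    6 K y. The factor 4^-L per vertex of [cover T] absorbs the powers of 5/4 and of 6 K, and the
    closed incident edges. *)
Lemma dense_family_sum v :
  \sum_(S in dense_family (k * n) L | v \in touched (star H) S)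
     spread_weight q (star H) S <= 1 / 4.
Proof.
have pn0 : 0 < p * n by apply: lt_le_trans pn1.
have q0 : 0 <= q by rewrite qE divr_ge0 // ltW.
have [y yE] : exists y : R, y = (6 * (p * n))^-1 by eexists.
have y0 : 0 < y by rewrite yE invr_gt0 mulr_gt0.
have y1 : y <= 1.
  have pn6 : 1 <= 6 * (p * n) by have := pn1; lra.
  by rewrite yE invf_le1 // (lt_le_trans ltr01).
have y01 : 0 <= y <= 1 by rewrite (ltW y0).
have qy : q = 6 * K%:R * y by rewrite qE yE; move: (p * n) pn0 => x x0; field; lra.
pose I := ({set {set V}} * {set {set V}})%type.
pose P (TS : I) := dense_pair (k * n) L TS.1 TS.2 && (v \in cover TS.1).
have coverU T S : dense_pair (k * n) L T S -> cover (T :|: S) = cover T.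
  case/and5P => _ _ _ /subsetP ST _; rewrite /cover bigcup_setU; apply/setUidPl.
  by apply/bigcupsP => e /ST /setDP[/setIdP[_ ->]].
apply: (@le_trans _ _ (\sum_(TS | P TS) spread_weight q (star H) (TS.1 :|: TS.2))).
  apply: sum_le_reindex => [S|S /andP[/imset2P[T S' _]]].
    by rewrite /spread_weight mulr_ge0 ?exprn_ge0 ?divr_ge0.
  rewrite inE => TS' -> vS; exists (T, S') => //=; rewrite /P TS' /=.
  by have := subsetP (touched_sub_cover _) _ vS; rewrite (coverU _ _ TS').
pose w T : R := (5 / 4) ^+ #|cover T| * q ^+ #|T| * q ^+ (L * #|cover T|).
apply: (@le_trans _ _ (\sum_(TS | P TS) w TS.1)).
  apply: ler_sum => -[T S] /andP[/= TS _]; rewrite /spread_weight /w mulrC -mulrA -exprD.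
  have -> : #|T :|: S| = (#|T| + L * #|cover T|)%N.
    case/and5P: TS => _ _ _ ST /eqP <-; rewrite cardsU disjoint_setI0 ?cards0 ?subn0 //.
    by rewrite disjoint_sym; apply: disjointWl ST _; rewrite disjoints_subset setDE subsetIr.
  rewrite ler_wpM2r ?exprn_ge0 // ler_weXn2l //; first lra.
  by rewrite -(coverU _ _ TS) subset_leq_card // touched_sub_cover.
rewrite (eq_bigl (fun TS : I => ([&& is_tree TS.1, TS.1 \subset edges H & v \in cover TS.1]
   && (#|cover TS.1|%:R <= k * n)) && dense_pair (k * n) L TS.1 TS.2)); last first.
  move=> [T S]; rewrite /P /=; apply/andP/andP => [[TS vT]|[/andP[/and3P[_ _ vT] _] TS]] //.
  by case/and5P: (TS) => -> -> -> _ _; rewrite vT.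
rewrite -(pair_big_dep (fun T => [&& is_tree T, T \subset edges H & v \in cover T]
   && (#|cover T|%:R <= k * n)) (fun T S => dense_pair (k * n) L T S) (fun T _ => w T)) /=.
apply: (@le_trans _ _ (\sum_(T | [&& is_tree T, T \subset edges H & v \in cover T])
     4^-1 * (y ^+ #|T| * (1 - y) ^+ #|incident (edges H) (cover T) :\: T|))); last first.
  rewrite -mulr_sumr mul1r -[leRHS]mulr1 ler_wpM2l ?invr_ge0 //.
  by apply: tree_sum => // e /edge_card.
rewrite big_mkcondr /=; apply: ler_sum => T /and3P[tT TH vT].
case: ifP => [Tk|_]; last first.
  by rewrite !mulr_ge0 ?exprn_ge0 ?invr_ge0 ?subr_ge0 // ltW.
rewrite sumr_const -[w T *+ _]mulr_natr.
rewrite (@eq_card _ _ (mem [set S | dense_pair (k * n) L T S])); last by move=> S; rewrite [RHS]inE.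
rewrite mulrC /w mulrA mulrAC.
have w0 : 0 <= (5 / 4 : R) ^+ #|cover T| * q ^+ #|T| by rewrite mulr_ge0 ?exprn_ge0 ?divr_ge0.
apply: le_trans (_ : _ <= 4^-1 ^+ (L * #|cover T|) * ((5 / 4) ^+ #|cover T| * q ^+ #|T|)) _.
  by rewrite ler_wpM2r // count_extensions.
(* Degrees are at most 3 p n = 1 / (2 y), so by Bernoulli closing all edges at one vertex costs at
   most a factor 2. *)
have inc : 2^-1 ^+ #|cover T| <= (1 - y) ^+ #|incident (edges H) (cover T) :\: T|.
  apply: (@le_trans _ _ ((1 - y) ^+ (max_degree H * #|cover T|))); last first.
    apply: ler_wiXn2l; rewrite ?subr_ge0 ?gerBl ?(ltW y0) //.
    by apply: leq_trans (card_incident _); rewrite subset_leq_card // subsetDl.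
  rewrite exprM; apply: lerXn2r; rewrite ?nnegrE ?invr_ge0 ?exprn_ge0 ?subr_ge0 //.
  apply: le_trans (bernoulli (max_degree H) y01).
  have : (max_degree H)%:R * y <= 2^-1.
    rewrite yE ler_pdivrMr; last exact: mulr_gt0.
    have -> : 2^-1 * (6 * (p * n)) = 3 * (p * n) by field.
    rewrite /max_degree; elim/big_ind: _ => [|a b|u _]; last exact: degH.
      by rewrite mulr_ge0 // ltW.
    by rewrite /maxn; case: ifP.
  move=> Dy; rewrite [leLHS](_ : _ = 1 - 2^-1); last by field.
  by rewrite lerD2l lerN2.
apply: (@le_trans _ _ (4^-1 * (y ^+ #|T| * 2^-1 ^+ #|cover T|))); last first.
  by rewrite !ler_wpM2l ?invr_ge0 ?exprn_ge0 // ltW.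
rewrite (card_tree tT) qy; set t := #|T|.
rewrite exprM.
set A : R := 4^-1 ^+ L.
have A0 : 0 <= A by rewrite exprn_ge0 ?invr_ge0.
have KA : 60 * K%:R * A <= 1.
  by rewrite /A exprVn ler_pdivrMr ?exprn_gt0 // mul1r.
have K1 : 1 <= K%:R :> R by rewrite ler1n.
have [KA' A'] := small_base A0 K1 KA.
have powers a b g : a ^+ t.+1 * (b ^+ t.+1 * (g * y) ^+ t) =
    y ^+ t * ((b * g * a) ^+ t * (b * a)) :> R.
  rewrite !exprS !exprMn; move: (a ^+ t) (b ^+ t) (g ^+ t) (y ^+ t) => a' b' g' y'.
  by ring.
rewrite powers.
have -> : 4^-1 * (y ^+ t * 2^-1 ^+ t.+1) = y ^+ t * (2^-1 ^+ t * (1 / 8)).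
  by rewrite exprS; move: (y ^+ t) (2^-1 ^+ t) => a b; field.
rewrite ler_wpM2l ?exprn_ge0 ?(ltW y0) //.
apply: ler_pM; rewrite ?exprn_ge0 ?mulr_ge0 ?divr_ge0 ?invr_ge0 //.
by apply: lerXn2r; rewrite ?nnegrE ?mulr_ge0 ?divr_ge0 ?invr_ge0.
Qed.

Definition conflict_family (H0 : sgraph V) (Gamma : conflict_graph H0) :
    {set {set {set V}}} :=
  [set [set val xy.1; val xy.2] | xy in [set xy | adj Gamma xy.1 xy.2]].

(** There are at most 3 p n edges at v, each with at most mu p n conflicts, and a conflicting pair
    touches at most four vertices. The total is at most 1875/256 times mu K^2. *)
Lemma conflict_family_sum (H0 : sgraph V) (Gamma : conflict_graph H0) (mu : R) v :
  spanning_subgraph H H0 -> 0 <= mu -> (max_degree Gamma)%:R <= mu * (p * n) ->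
  30 * mu * K%:R ^+ 2 <= 1 ->
  \sum_(S in conflict_family Gamma | v \in touched (star H) S)
     spread_weight q (star H) S <= 1 / 4.
Proof.
move=> HH0 mu0 Gmu muK.
have pn0 : 0 < p * n by apply: lt_le_trans pn1.
have q0 : 0 <= q by rewrite qE divr_ge0 // ltW.
pose P (xy : {e | e \in edges H0} * {e | e \in edges H0}) :=
  (val xy.1 \in star H v) && adj Gamma xy.1 xy.2.
apply: (@le_trans _ _ (\sum_(xy | P xy) spread_weight q (star H) [set val xy.1; val xy.2])).
  apply: (sum_le_reindex (g := fun xy => [set val xy.1; val xy.2])).
    by move=> S; rewrite /spread_weight mulr_ge0 ?exprn_ge0 ?divr_ge0.
  move=> S /andP[/imsetP[[x y]]]; rewrite inE /= => xy ->.
  rewrite inE => /set0Pn[e /setIP[ev]]; rewrite !inE => /orP[] /eqP ee.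
    by exists (x, y); rewrite // /P /= -ee ev.
  by exists (y, x); [rewrite /P /= -ee ev adjC | rewrite /= setUC].
apply: (@le_trans _ _ (\sum_(xy | P xy) (q ^+ 2 * (5 / 4) ^+ 4))).
  apply: ler_sum => -[x y] /andP[/= xv xy].
  have xyn : val x != val y by rewrite (inj_eq val_inj) (adj_neq xy).
  rewrite /spread_weight cards2 xyn ler_wpM2l ?exprn_ge0 // ler_weXn2l //; first lra.
  apply: leq_trans (subset_leq_card (touched_sub_cover _)) _.
  apply: leq_trans (card_cover_le _) _; last by rewrite cards2 xyn.
  by move=> e; rewrite !inE => /orP[] /eqP->; apply: edge_card (valP _).
rewrite -(pair_big_dep (fun x : {e | e \in edges H0} => val x \in star H v)
  (fun x y => adj Gamma x y) (fun _ _ => q ^+ 2 * (5 / 4) ^+ 4)) /=.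
apply: (@le_trans _ _ (\sum_(x : {e | e \in edges H0} | val x \in star H v)
  mu * (p * n) * (q ^+ 2 * (5 / 4) ^+ 4))).
  apply: ler_sum => x _; rewrite sumr_const -[_ *+ #|_|]mulr_natl ler_wpM2r //.
    by rewrite mulr_ge0 ?exprn_ge0 ?divr_ge0.
  apply: le_trans Gmu; rewrite ler_nat; apply: leq_trans (deg_le_max Gamma x).
  by apply: subset_leq_card; apply/subsetP => y; rewrite inE.
rewrite sumr_const -[_ *+ #|_|]mulr_natl.
have cs : #|[pred x : {e | e \in edges H0} | val x \in star H v]|%:R <= 3 * (p * n).
  apply: le_trans (degH v); rewrite ler_nat deg_star.
  rewrite -(card_imset _ val_inj); apply: subset_leq_card; apply/subsetP => e.
  by case/imsetP => x; rewrite inE => xv ->.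
apply: le_trans (ler_wpM2r _ cs) _.
  apply: mulr_ge0; first exact: mulr_ge0 mu0 (ltW pn0).
  by rewrite mulr_ge0 ?exprn_ge0 ?divr_ge0.
have -> : 3 * (p * n) * (mu * (p * n) * (q ^+ 2 * (5 / 4) ^+ 4)) =
  (mu * K%:R ^+ 2) * (3 * (5 / 4) ^+ 4).
  by rewrite qE; move: (p * n) pn0 => x x0; field; lra.
have -> : (3 * (5 / 4) ^+ 4 : R) = 1875 / 256 by field.
by move: muK; rewrite -mulrA; lra.
Qed.

End BadFamily.

(** * The conditioned sample *)

Section Sampling.
Variables (R : realType) (V : finType) (H0 H : sgraph V).
Variables (Gamma : conflict_graph H0) (p c k eps eta rho mu : R) (K L : nat).
Variables (n q : R).
Implicit Types (X Y S : {set {set V}}) (F : sgraph V) (v : V).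

Definition enough v X := (1 / 2 + eps / 4) * K%:R <= (deg (restrict H X) v)%:R.

Definition overfull (UW : {set V} * {set V}) X :=
  (1 + rho) * eta * K%:R * #|UW.1|%:R < (edges_between (restrict H X) UW.1 UW.2)%:R.

(** For smaller pairs the union of U and W has at most k n vertices and is controlled by
    [dense_family]. *)
Definition large_pair (UW : {set V} * {set V}) :=
  [&& #|UW.1| == #|UW.2|, k * n / 2 < #|UW.1|%:R & #|UW.1|%:R <= eta * n].

(** The ordered count over all of V is twice the number of edges, whence the threshold 4 K n for 2 K
    n edges. *)
Definition globally_bad X :=
  [exists (UW | large_pair UW), overfull UW X] ||
  (4 * K%:R * n < (edges_between (restrict H X) setT setT)%:R).

Definition bad_family := conflict_family Gamma :|: dense_family H (k * n) L.

Lemma star_restrict X v : star (restrict H X) v = X :&: star H v.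
Proof. by apply/setP => e; rewrite !inE andbAC andbC. Qed.

Lemma restrict_mono X Y : X \subset Y -> spanning_subgraph (restrict H X) (restrict H Y).
Proof. by move=> XY; apply: setIS. Qed.

Lemma enough_up v : up_event (enough v).
Proof.
move=> X Y XY; rewrite /enough => /le_trans; apply.
by rewrite ler_nat !deg_star !star_restrict subset_leq_card // setSI.
Qed.

Lemma enough_star v X : enough v X = enough v (X :&: star H v).
Proof. by rewrite /enough !deg_star !star_restrict -setIA setIid. Qed.

Lemma globally_bad_up : up_event globally_bad.
Proof.
move=> X Y XY; have mono A B : (edges_between (restrict H X) A B)%:R <=
    (edges_between (restrict H Y) A B)%:R :> R.
  by rewrite ler_nat edges_between_sub // restrict_mono.
case/orP => [/exists_inP[UW lUW oUW]|bE]; apply/orP; [left | right].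
  by apply/exists_inP; exists UW => //; apply: lt_le_trans oUW (mono _ _).
exact: lt_le_trans bE (mono _ _).
Qed.

(** Otherwise [dense_tree] finds in the sample a tree T with at least L |cover T| further edges
    inside [cover T]; any L |cover T| of them, with T, form a forbidden set. *)
Lemma avoids_dense X (Z : {set V}) :
  avoids (dense_family H (k * n) L) X -> Z != set0 -> #|Z|%:R <= k * n ->
  (#|inside (edges H :&: X) Z| <= L.+1 * #|Z|)%N.
Proof.
move=> aX Z0 Zk; rewrite leqNgt; apply/negP => /ltnW dZ.
have F2 : {in edges H :&: X, forall e : {set V}, #|e| = 2} by move=> e /setIP[/edge_card].
have [T [tT TF TZ dT]] := dense_tree F2 Z0 dZ.
have [TH TX] : T \subset edges H /\ T \subset X by apply/andP; rewrite -subsetI.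
have TI : T \subset inside (edges H :&: X) (cover T).
  by apply/subsetP => e eT; rewrite inE (subsetP TF) // sub_cover.
have [|S SI cS] := @subset_of_card _ (inside (edges H :&: X) (cover T) :\: T) (L * #|cover T|).
  by rewrite cardsD (setIidPr TI) leq_subRL ?subset_leq_card // addnC.
have II : inside (edges H :&: X) (cover T) \subset inside (edges H) (cover T).
  by apply/subsetP => e /setIdP[/setIP[eH _] eC]; rewrite inE eH.
have SX : S \subset X.
  by apply: subset_trans SI _; apply/subsetP => e /setDP[/setIdP[/setIP[]]].
move/forall_inP: aX => /(_ (T :|: S)); rewrite subUset TX SX => aX.
suff /aX : T :|: S \in dense_family H (k * n) L by [].
apply/imset2P; exists T S; rewrite ?inE // /dense_pair tT TH cS eqxx andbT /=.
apply/andP; split; last by apply: subset_trans SI _; apply: setSD.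
by apply: le_trans Zk; rewrite ler_nat subset_leq_card.
Qed.

Hypotheses (nE : n = #|V|%:R) (qE : q = K%:R / (p * n)).
Hypotheses (p0 : 0 < p) (pn1 : 1 <= p * n) (q1 : q < 1).
Hypotheses (heps : 0 < eps < 1 / 2) (heta : 0 < eta < 1 / 4) (hrho : 0 < rho < 1 / 4).
Hypotheses (n3 : (3 <= #|V|)%N) (L0 : (0 < L)%N).
Hypotheses (K76 : (76 <= K)%N) (Keps : 576 <= K%:R * eps ^+ 2).
Hypotheses (Krho : 1216 <= eta * K%:R * rho ^+ 2 * k) (KL : 60 * K%:R <= 4 ^+ L :> R).
Hypotheses (kK : 16 * k * K%:R <= L%:R) (LK : 4 * L.+1%:R <= eta * K%:R).
Hypotheses (ck : c <= k) (ceta : 8 * c <= eta * rho).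
Hypotheses (mu0 : 0 <= mu) (muK : 30 * mu * K%:R ^+ 2 <= 1).
Hypothesis HH0 : spanning_subgraph H H0.
Hypothesis jumbledH : upper_jumbled p c H.
Hypothesis degH : forall v, (1 / 2 + eps / 2) * (p * n) <= (deg H v)%:R <= 3 * (p * n).
Hypothesis Gmu : (max_degree Gamma)%:R <= mu * (p * n).

Lemma q01 : 0 <= q <= 1.
Proof. by rewrite (ltW q1) andbT qE divr_ge0 // (le_trans ler01). Qed.

Lemma expR_small (x m : R) : m * (#|V|)%:R <= x -> 0 <= m -> expR (- x) <= (1 + m)^-1 ^+ #|V|.
Proof.
move=> mx m0; apply: (@le_trans _ _ (expR (- (m * #|V|%:R)))).
  by rewrite ler_expR lerN2.
rewrite -mulNr expRM_natr; apply: lerXn2r; rewrite ?nnegrE ?expR_ge0 ?invr_ge0 ?addr_ge0 //.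
by rewrite expRN lef_pV2 ?posrE ?expR_gt0 ?expR_ge1Dx // ltr_pwDl.
Qed.

(** Chernoff with h = eps/8: the mean is at least (1/2 + eps/2) K, so the exponent is at most -K
    eps^2 / 64, hence at most -9. *)
Lemma enough_likely v : Pr q (predC (enough v)) <= 1 / 10.
Proof.
have /andP[e0 e1] := heps; have pn0 : 0 < p * n by apply: lt_le_trans pn1.
have h0 : 0 <= eps / 8 by lra.
have := chernoff_lower q01 H v ((1 / 2 + eps / 4) * K%:R) h0.
move=> ch; apply: le_trans (le_trans ch _).
  by apply: (ler_Pr q01) => X /=; rewrite /enough -ltNge.
have qd : (1 / 2 + eps / 2) * K%:R <= q * (deg H v)%:R.
  have /andP[dv _] := degH v.
  rewrite qE mulrAC ler_pdivlMr //.
  have -> : (1 / 2 + eps / 2) * K%:R * (p * n) = K%:R * ((1 / 2 + eps / 2) * (p * n)) by ring.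
  by rewrite ler_wpM2l.
have hh : eps / 8 * (1 - eps / 8) <= eps / 8 / (1 + eps / 8).
  rewrite ler_pdivlMr; last lra.
  have -> : eps / 8 * (1 - eps / 8) * (1 + eps / 8) = eps / 8 - (eps / 8) ^+ 3 by ring.
  by rewrite gerBl exprn_ge0.
have hq : (1 / 2 + eps / 2) * K%:R * (eps / 8 * (1 - eps / 8)) <=
          q * (deg H v)%:R * (eps / 8 / (1 + eps / 8)).
  have h1 : 0 <= eps / 8 * (1 - eps / 8) by rewrite mulr_ge0 //; lra.
  apply: ler_pM => //; rewrite mulr_ge0 //; lra.
apply: (@le_trans _ _ (expR (- 9))); last first.
  rewrite expRN -div1r ler_pdivrMr ?expR_gt0 //.
  by have := expR_ge1Dx (9 : R); lra.
rewrite ler_expR.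
have key : eps / 8 * ((1 / 2 + eps / 4) * K%:R) -
    (1 / 2 + eps / 2) * K%:R * (eps / 8 * (1 - eps / 8)) <= - (K%:R * eps ^+ 2 / 64).
  have -> : eps / 8 * ((1 / 2 + eps / 4) * K%:R) -
    (1 / 2 + eps / 2) * K%:R * (eps / 8 * (1 - eps / 8)) =
    - (K%:R * eps ^+ 2 / 64) - K%:R * eps ^+ 2 * (1 / 128 - eps / 128) by field.
  rewrite gerBl mulr_ge0 ?mulr_ge0 ?sqr_ge0 //; lra.
by have := Keps; lra.
Qed.

Lemma mean_bound (A B : {set V}) : #|A| = #|B| ->
  q * (edges_between H A B)%:R * n <= K%:R * #|A|%:R * (#|A|%:R + c * n).
Proof.
move=> AB; have := jumbledH A B; rewrite -AB -expr2 sqrtr_sqr ger0_norm // -nE => jAB.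
have pn0 : 0 < p * n by apply: lt_le_trans pn1.
have nn : n != 0 by apply: contraTneq pn0 => ->; rewrite mulr0 ltxx.
have := ler_wpM2l (ler0n R K) jAB.
have -> : q * (edges_between H A B)%:R * n = (K%:R * (edges_between H A B)%:R) / p.
  by rewrite qE; field; rewrite nn gt_eqF.
rewrite ler_pdivrMr // => /le_trans; apply.
by rewrite le_eqVlt; apply/orP; left; apply/eqP; ring.
Qed.

(** Chernoff with h = rho/16: for y = eta K |U| the mean is at most y (1 + rho/8), and the exponent
    is at most -y rho^2 / 32. Since |U| > k n / 2, this is at most -19 n, where 1216 = 64 * 19. *)
Lemma pair_likely UW : large_pair UW -> Pr q (overfull UW) <= 20^-1 ^+ #|V|.
Proof.
case: UW => U W /and3P[/= /eqP UW kU Ue]; have /andP[r0 r1] := hrho; have /andP[e0 e1] := heta.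
have n0 : 0 < n by rewrite nE ltr0n (leq_trans _ n3).
have h : 0 <= rho / 16 < 1 / 2 by apply/andP; lra.
have := chernoff_upper q01 H U W ((1 + rho) * eta * K%:R * #|U|%:R) h.
move=> ch; apply: le_trans (le_trans ch _).
  by apply: (ler_Pr q01) => X /ltW.
set M := q * _; set u : R := #|U|%:R in kU Ue *; set y := eta * K%:R * u.
have y0 : 0 <= y by rewrite /y !mulr_ge0 // ltW.
have My : M <= y * (1 + rho / 8).
  rewrite -(ler_pM2r n0); apply: le_trans (mean_bound UW) _; rewrite -/u.
  have -> : y * (1 + rho / 8) * n = K%:R * u * ((eta + eta * rho / 8) * n) by rewrite /y; ring.
  apply: ler_wpM2l; first by rewrite mulr_ge0.
  have : c * n <= eta * rho / 8 * n by rewrite ler_wpM2r ?(ltW n0) //; have := ceta; lra.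
  by move: Ue; lra.
have hh : rho / 16 / (1 - 2 * (rho / 16)) <= rho / 16 * (1 + rho / 4).
  rewrite ler_pdivrMr; last lra.
  have -> : rho / 16 * (1 + rho / 4) * (1 - 2 * (rho / 16)) =
    rho / 16 + rho / 16 * (rho / 8) * (1 - rho / 4) by field.
  by rewrite lerDl !mulr_ge0 //; lra.
have hM : M * (rho / 16 / (1 - 2 * (rho / 16))) <=
          y * (1 + rho / 8) * (rho / 16 * (1 + rho / 4)).
  have h1 : 0 <= rho / 16 / (1 - 2 * (rho / 16)) by rewrite divr_ge0 //; lra.
  apply: le_trans (ler_wpM2r h1 My) _; apply: ler_wpM2l => //.
  by rewrite mulr_ge0 //; lra.
have key : M * (rho / 16 / (1 - 2 * (rho / 16))) - rho / 16 * ((1 + rho) * eta * K%:R * u) <=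
  - (y * rho ^+ 2 / 32).
  have -> : rho / 16 * ((1 + rho) * eta * K%:R * u) = rho / 16 * (1 + rho) * y by rewrite /y; ring.
  apply: le_trans (lerB hM (lexx _)) _.
  have -> : y * (1 + rho / 8) * (rho / 16 * (1 + rho / 4)) - rho / 16 * (1 + rho) * y =
    - (y * rho ^+ 2 / 32) - y * rho ^+ 2 / 16 * (1 / 8 - rho / 32) by field.
  by rewrite gerBl !mulr_ge0 ?sqr_ge0 //; lra.
apply: (@le_trans _ _ (expR (- (y * rho ^+ 2 / 32)))); first by rewrite ler_expR.
have -> : (20 : R) = 1 + 19 by ring.
apply: expR_small => //; rewrite -nE.
have : eta * K%:R * rho ^+ 2 * (k * n / 2) <= eta * K%:R * rho ^+ 2 * u.
  by apply: ler_wpM2l (ltW kU); rewrite !mulr_ge0 ?sqr_ge0 // ltW.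
have : 1216 * n <= eta * K%:R * rho ^+ 2 * k * n by rewrite ler_wpM2r ?Krho // ltW.
by rewrite /y; lra.
Qed.

Lemma edges_likely :
  Pr q (fun X => 4 * K%:R * n < (edges_between (restrict H X) setT setT)%:R) <= 20^-1 ^+ #|V|.
Proof.
have n0 : 0 < n by rewrite nE ltr0n (leq_trans _ n3).
have h : 0 <= (8^-1 : R) < 1 / 2 by apply/andP; lra.
have := chernoff_upper q01 H setT setT (4 * K%:R * n) h.
move=> ch; apply: le_trans (le_trans ch _).
  by apply: (ler_Pr q01) => X /ltW.
have -> : 8^-1 / (1 - 2 * 8^-1) = 6^-1 :> R by field.
set M := q * _.
have c1 : c <= 1 / 4.
  have /andP[r0 r1] := hrho; have /andP[e0 e1] := heta.
  have : eta * rho <= 1 * 1 by apply: ler_pM; lra.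
  by have := ceta; lra.
have MK : M <= K%:R * n * (5 / 4).
  rewrite -(ler_pM2r n0); apply: le_trans (mean_bound (erefl _)) _.
  rewrite cardsT -nE -mulrA; rewrite -!mulrA ler_wpM2l // ler_wpM2l ?(ltW n0) //.
  have : c * n <= 1 / 4 * n by rewrite ler_wpM2r // ltW.
  lra.
have K76' : 76 <= K%:R :> R by rewrite ler_nat.
have Kn : 76 * n <= K%:R * n by rewrite ler_wpM2r // ltW.
apply: (@le_trans _ _ (expR (- (K%:R * n / 4)))).
  by rewrite ler_expR; have : 0 <= K%:R * n by [rewrite mulr_ge0 // ltW]; lra.
have -> : (20 : R) = 1 + 19 by ring.
by apply: expR_small => //; rewrite -nE; lra.
Qed.

(** A union bound over 4^n pairs leaves 2 * 4^-n * (4/5)^n, and n >= 3 gives the 1/32. The power of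
    4/5 is kept to cancel the loss in [local_lemma]. *)
Lemma globally_bad_unlikely : Pr q globally_bad <= 32^-1 * (4 / 5) ^+ #|V|.
Proof.
have un : Pr q globally_bad <= 4 ^+ #|V| * 20^-1 ^+ #|V| + 20^-1 ^+ #|V|.
  apply: (@le_trans _ _ (Pr q (fun X => [exists (UW | large_pair UW), overfull UW X]) +
     Pr q (fun X => 4 * K%:R * n < (edges_between (restrict H X) setT setT)%:R))).
    rewrite /Pr -expectD; apply: (ler_expect q01) => X; rewrite /globally_bad.
    by rewrite -natrD ler_nat; case: [exists (UW | large_pair UW), overfull UW X].
  apply: lerD; last exact: edges_likely.
  apply: le_trans (Pr_exists q01 _ _) _.
  apply: (@le_trans _ _ (\sum_(UW : {set V} * {set V}) 20^-1 ^+ #|V|)); last first.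
    have cV : #|{: {set V}}| = (2 ^ #|V|)%N.
      by rewrite -(cardsT V) -card_powerset powersetT cardsT.
    by rewrite sumr_const card_prod cV -expnMn -[X in X <= _]mulr_natl natrX.
  rewrite big_mkcond /=; apply: ler_sum => UW _; case: ifP => [/pair_likely//|_].
  by rewrite exprn_ge0 ?invr_ge0.
apply: le_trans un _.
have x0 : 0 <= (20^-1 : R) ^+ #|V| by rewrite exprn_ge0 ?invr_ge0.
have h1 : 1 <= (4 : R) ^+ #|V| by rewrite exprn_ege1 // ler1n.
apply: (@le_trans _ _ (2 * (4 ^+ #|V| * 20^-1 ^+ #|V|))).
  by have : 1 * (20^-1 : R) ^+ #|V| <= 4 ^+ #|V| * 20^-1 ^+ #|V| by [rewrite ler_wpM2r]; lra.
rewrite -exprMn; have -> : 4 * 20^-1 = 4^-1 * (4 / 5) :> R by field.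
rewrite exprMn mulrA ler_wpM2r ?exprn_ge0 ?divr_ge0 //.
have : (4^-1 : R) ^+ #|V| <= 4^-1 ^+ 3 by rewrite ler_wiXn2l ?invr_ge0 ?invf_le1 // ler1n.
have -> : (4^-1 : R) ^+ 3 = 64^-1 by field.
lra.
Qed.

Lemma bad_sparse_family : sparse_family q (star H) bad_family.
Proof.
have degH' v : (deg H v)%:R <= 3 * (p * n) by have /andP[] := degH v.
have K0 : (0 < K)%N by apply: leq_trans K76.
move=> v; rewrite (bigID (mem (conflict_family Gamma))) /=.
have -> : (1 / 2 : R) = 1 / 4 + 1 / 4 by field.
have sw S : 0 <= spread_weight q (star H) S.
  by have /andP[q0 _] := q01; rewrite mulr_ge0 ?exprn_ge0 ?divr_ge0.
apply: lerD.
  apply: le_trans (conflict_family_sum qE pn1 degH' v HH0 mu0 Gmu muK).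
  rewrite le_eqVlt; apply/orP; left; apply/eqP; apply: eq_bigl => S.
  by rewrite !inE; case: (S \in conflict_family Gamma); rewrite /= ?andbT ?andbF.
apply: le_trans (dense_family_sum nE qE p0 pn1 K0 L0 jumbledH degH' ck kK KL v).
rewrite [leRHS](bigID (fun S => S \in conflict_family Gamma)) /=.
rewrite -[leLHS]add0r lerD ?sumr_ge0 //.
rewrite le_eqVlt; apply/orP; left; apply/eqP; apply: eq_bigl => S.
by rewrite !inE; case: (S \in conflict_family Gamma); rewrite /= ?andbT ?andbF.
Qed.

Definition acceptable X :=
  [&& all_good enough setT X, avoids bad_family X & ~~ globally_bad X].

Let base := joint q enough setT bad_family.

(** Being globally bad is increasing and avoidance is decreasing, so Harris' inequality bounds their
    intersection by the product; [local_lemma] turns the avoidance probability into [base]. *)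
Lemma acceptable_likely : 31 / 32 * base <= Pr q acceptable.
Proof.
have ll := local_lemma q01 enough_up enough_star enough_likely bad_sparse_family.
have hb : Pr q (fun X => [&& globally_bad X, avoids bad_family X & true]) <= 32^-1 * base.
  have := @harris_up R _ q q01 setT globally_bad (avoids bad_family) predT
    globally_bad_up (@avoids_down _ bad_family).
  move=> /(_ (fun X => congr1 globally_bad (esym (setIT X))) (fun=> erefl)) hu.
  apply: le_trans hu _.
  have -> : Pr q (predI (avoids bad_family) predT) = Pr q (avoids bad_family).
    by apply: eq_expect => X /=; rewrite andbT.
  apply: le_trans (ler_pM _ _ globally_bad_unlikely ll) _; rewrite ?Pr_ge0 ?q01 //.
  rewrite mulrA -[_ * _ * _ ^+ _]mulrA -exprMn.
  by have -> : 4 / 5 * (5 / 4) = 1 :> R; [field | rewrite expr1n mulr1].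
have bs : base = Pr q (predI (predI (all_good enough setT) (avoids bad_family)) globally_bad)
   + Pr q acceptable.
  rewrite /base /joint [LHS](Pr_split _ _ globally_bad); congr (_ + _).
  by apply: eq_expect => X /=; rewrite /acceptable andbC andbA.
have : Pr q (predI (predI (all_good enough setT) (avoids bad_family)) globally_bad) <=
   Pr q (fun X => [&& globally_bad X, avoids bad_family X & true]).
  by apply: (ler_Pr q01) => X /= /andP[/andP[_ ->] ->].
by move: hb bs; lra.
Qed.

(** Every forbidden set is nonempty, so the empty sample, of positive probability because q < 1,
    avoids them all. *)
Lemma base_gt0 : 0 < base.
Proof.
have ll := local_lemma q01 enough_up enough_star enough_likely bad_sparse_family.
have pos : 0 < Pr q (avoids bad_family).
  have : 0 < Pr q (fun X : {set {set V}} => X :&: setT == set0).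
    by rewrite Pr_setI_eq ?sub0set // cards0 expr0 mul1r exprn_gt0 // subr_gt0.
  move/lt_le_trans; apply; apply: (ler_Pr q01) => X; rewrite setIT => /eqP->.
  apply/forall_inP => S SJ; rewrite subset0; apply: contraTneq SJ => ->.
  rewrite inE negb_or; apply/andP; split.
    by apply/imsetP => -[xy _] /setP/(_ (val xy.1)); rewrite !inE eqxx.
  apply/imset2P => -[T S' _]; rewrite inE => /and5P[tT _ _ _ _] /esym/eqP.
  rewrite setU_eq0 => /andP[/eqP T0 _]; move: (card_tree tT).
  by rewrite T0 /cover big_set0 !cards0.
have := lt_le_trans pos ll; rewrite pmulr_rgt0 // exprn_gt0 // divr_gt0 //.
Qed.

Definition sample : {ffun sgraph V -> R} :=
  [ffun F => Pr q (fun X => (restrict H X == F) && acceptable X) / Pr q acceptable].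

Lemma acceptable_gt0 : 0 < Pr q acceptable.
Proof. by have := base_gt0; have := acceptable_likely; lra. Qed.

Lemma prob_sample (P : pred (sgraph V)) :
  prob sample P = Pr q (fun X => P (restrict H X) && acceptable X) / Pr q acceptable.
Proof.
rewrite /prob (eq_bigr (fun F => Pr q (fun X => (restrict H X == F) && acceptable X) /
  Pr q acceptable)); last by move=> F _; rewrite ffunE.
rewrite -mulr_suml -expect_sum; congr (_ / _); apply: eq_expect => X.
have [PX|nPX] := boolP (P (restrict H X)).
  rewrite (bigD1 (restrict H X)) //= eqxx big1 ?addr0 // => F /andP[_ FX].
  by rewrite eq_sym (negPf FX).
by rewrite big1 // => F PF; case: eqP => // XF; rewrite XF PF in nPX.
Qed.

Lemma sample_support F : F \in law_support sample ->
  exists2 X, F = restrict H X & acceptable X.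
Proof.
rewrite inE ffunE; case: (pickP (fun X => (restrict H X == F) && acceptable X)).
  by move=> X /andP[/eqP<-]; exists X.
move=> none; have -> : Pr q (fun X => (restrict H X == F) && acceptable X) = 0.
  by rewrite -(@expect_cst R {set V} q 0); apply: eq_expect => X; rewrite none.
by rewrite mul0r ltxx.
Qed.

Lemma acceptable_conflict_free X : acceptable X ->
  restrict H X \in conflict_free_subgraphs Gamma.
Proof.
case/and3P => _ aX _; rewrite inE; apply/andP; split.
  by apply: subset_trans HH0; apply: subsetIl.
apply/forall_inP => x; rewrite inE => /setIP[_ xX].
apply/forall_inP => y; rewrite inE => /setIP[_ yX]; apply/negP => xy.
move/forall_inP: aX => /(_ [set val x; val y]); rewrite subUset !sub1set xX yX => aX.
suff /aX : [set val x; val y] \in bad_family by [].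
by apply/setUP; left; apply/imsetP; exists (x, y); rewrite ?inE.
Qed.

(** Large pairs are not overfull. For a small pair, Z = U :|: W spans at most (L + 1) |Z| edges, so
    the count is at most 4 (L + 1) |U|, hence at most eta K |U|. *)
Lemma acceptable_sparse X : acceptable X -> sparse eta rho (K%:R / n) (restrict H X).
Proof.
case/and3P => _ aX; rewrite negb_or => /andP[/exists_inPn nbad _] U W UW.
have /andP[e0 _] := heta; have /andP[r0 _] := hrho.
have K0 : 0 < K%:R :> R by rewrite ltr0n (leq_trans _ K76).
have n0 : 0 < n by rewrite nE ltr0n (leq_trans _ n3).
have cancel a : a * (K%:R / n) * n = a * K%:R by rewrite -mulrA divfK ?gt_eqF.
rewrite -nE !cancel.
move=> eU Ue; have U0 : 0 < #|U|%:R :> R by apply: lt_le_trans eU; apply: mulr_gt0.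
have [kU|kU] := ltP (k * n / 2) #|U|%:R.
  by rewrite leNgt; apply: (nbad (U, W)); apply/and3P; split=> //=; apply/eqP.
pose Z := U :|: W.
have cZ : (#|Z| <= 2 * #|U|)%N by rewrite mul2n -addnn [X in (_ + X)%N]UW leq_card_setU.
have Z0 : Z != set0 by rewrite setU_eq0 negb_and -card_gt0 -(ltr0n R) U0.
have Zk : #|Z|%:R <= k * n.
  have : #|Z|%:R <= (2 * #|U|)%:R :> R by rewrite ler_nat.
  by rewrite natrM; move: kU; lra.
have aX' : avoids (dense_family H (k * n) L) X.
  by apply/forall_inP => S SJ; move/forall_inP: aX; apply; rewrite inE SJ orbT.
have dZ := avoids_dense aX' Z0 Zk.
have : (edges_between (restrict H X) U W <= 4 * L.+1 * #|U|)%N.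
  apply: leq_trans (edges_between_mono _ (subsetUl U W) (subsetUr U W)) _.
  rewrite edges_between_inside -/Z; apply: leq_trans (leq_mul (leqnn 2) dZ) _.
  rewrite -[4%N]/(2 * 2)%N -!mulnA leq_mul2l /= [X in (_ <= X)%N]mulnCA leq_mul2l cZ.
  by rewrite orbT.
rewrite -(ler_nat R) !natrM => /le_trans; apply.
rewrite ler_wpM2r //; apply: le_trans LK _.
by rewrite -mulrA ler_peMl ?mulr_ge0 ?ltW // ltrDl.
Qed.

Lemma acceptable_degree X : acceptable X ->
  (1 / 2 + eps / 4) * K%:R <= (min_degree (restrict H X))%:R.
Proof.
case/and3P => /forall_inP gX _ _.
apply: (min_degree_ind (P := fun d => (1 / 2 + eps / 4) * K%:R <= d%:R)); last first.
  by move=> v; apply: gX; rewrite inE.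
(* The default value #|V| of the minimum must satisfy the bound too: it exceeds a degree in H, and K
   <= p n because q < 1. *)
have /andP[e0 e1] := heps; have pn0 : 0 < p * n by apply: lt_le_trans pn1.
have n0 : 0 < n by rewrite nE ltr0n (leq_trans _ n3).
have [v vV] : exists v : V, v \in V by apply/card_gt0P; rewrite (leq_trans _ n3).
have Kpn : K%:R <= p * n by move: (ltW q1); rewrite qE ler_pdivrMr // mul1r.
have /andP[dv _] := degH v.
have dn : (deg H v)%:R <= #|V|%:R :> R by rewrite ler_nat max_card.
apply: le_trans dn; apply: le_trans dv; apply: le_trans (_ : _ <= (1 / 2 + eps / 4) * (p * n)) _.
  by apply: ler_wpM2l => //; lra.
by apply: ler_wpM2r; [exact: ltW | lra].
Qed.

Lemma acceptable_edges X : acceptable X ->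
  (num_edges (restrict H X))%:R <= 2 * K%:R * n.
Proof.
case/and3P => _ _; rewrite negb_or -leNgt => /andP[_]; rewrite edges_between_inside natrM.
have -> : inside (edges (restrict H X)) setT = edges (restrict H X).
  by apply/setP => e; rewrite !inE subsetT andbT.
by rewrite /num_edges; lra.
Qed.

Lemma sample_spread S : S \subset edges H0 ->
  prob sample [pred F : sgraph V | S \subset edges F] <= q ^+ #|S| * (4 / 3) ^+ #|cover S|.
Proof.
move=> SH; have Z0 := acceptable_gt0; have /andP[q0 _] := q01.
rewrite prob_sample ler_pdivrMr //.
have [->|[e eS]] := set_0Vmem S.
  rewrite cards0 /cover big_set0 cards0 !expr0 !mul1r.
  by apply: (ler_Pr q01) => X /andP[].
(* Conditioning costs a factor 32/31. One vertex of [cover S] absorbs it, since 32/31 * 5/4 <= 4/3;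
   this is why the empty S is treated apart. *)
have cS : exists m, #|cover S| = m.+1.
  have e2 := edge_card (subsetP SH e eS).
  have : (0 < #|cover S|)%N.
    by apply: leq_trans (subset_leq_card (sub_cover eS)); rewrite e2.
  by case: #|cover S| => // m _; exists m.
have sp := local_lemma_spread q01 enough_up enough_star enough_likely S bad_sparse_family.
apply: le_trans (_ : _ <= spread_weight q (star H) S * base) _.
  apply: le_trans sp; apply: (ler_Pr q01) => X /andP[/= SX /and3P[-> -> _]].
  by rewrite (subset_trans SX) // subsetIr.
have acc := acceptable_likely.
apply: (@le_trans _ _ (q ^+ #|S| * (5 / 4) ^+ #|cover S| * base)).
  rewrite ler_wpM2r ?(ltW base_gt0) // ler_wpM2l ?exprn_ge0 //.
  by rewrite ler_weXn2l //; [lra | apply: subset_leq_card; apply: touched_sub_cover].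
have [m ->] := cS.
apply: (@le_trans _ _ (q ^+ #|S| * (5 / 4) ^+ m.+1 * (32 / 31 * Pr q acceptable))).
  rewrite ler_wpM2l ?mulr_ge0 ?exprn_ge0 ?divr_ge0 //; by move: acc; lra.
rewrite mulrA ler_wpM2r ?(ltW Z0) // -mulrA ler_wpM2l ?exprn_ge0 //.
rewrite !exprS mulrAC ler_pM ?exprn_ge0 ?divr_ge0 //; first by rewrite mulr_ge0 ?divr_ge0.
  lra.
by apply: lerXn2r; rewrite ?nnegrE ?divr_ge0 //; lra.
Qed.

Lemma sample_probability : probability_on (conflict_free_subgraphs Gamma) sample.
Proof.
have Z0 := acceptable_gt0.
have supp F : F \notin conflict_free_subgraphs Gamma -> sample F = 0.
  move=> FD; rewrite ffunE; apply/eqP; rewrite mulf_eq0; apply/orP; left; apply/eqP.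
  rewrite -(@expect_cst R {set V} q 0); apply: eq_expect => X; case: andP => // -[/eqP XF aX].
  by move: FD; rewrite -XF acceptable_conflict_free.
split=> // [F|]; first by rewrite ffunE divr_ge0 // ?Pr_ge0 ?q01 // ltW.
transitivity (prob sample predT).
  by rewrite /prob [RHS](bigID (mem (conflict_free_subgraphs Gamma))) /= [X in _ + X]big1 ?addr0.
by rewrite prob_sample divff // gt_eqF.
Qed.

End Sampling.

(** * Choice of the constants *)

(** L is taken large first, then K is about 4 (L + 1) / eta, so that eta K <= 9 L. The value k =
    eta/144 then gives 16 k K <= L, and L >= 540 / eta gives 60 K <= L^2 <= 4^L. *)
Lemma exists_sizes (R : realType) (eps eta rho : R) :
  0 < eps < 1 / 2 -> 0 < eta < 1 / 4 -> 0 < rho < 1 / 4 ->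
  exists K L : nat, [/\ (0 < L)%N, (76 <= K)%N & 576 <= K%:R * eps ^+ 2] /\
    [/\ 1216 <= eta * K%:R * rho ^+ 2 * (eta / 144), 60 * K%:R <= 4 ^+ L :> R,
        16 * (eta / 144) * K%:R <= L%:R & 4 * L.+1%:R <= eta * K%:R].
Proof.
move=> /andP[e0 e1] /andP[t0 t1] /andP[r0 r1].
pose x : R := 540 / eta + 576 / eps ^+ 2 + (1216 * 144) / (eta ^+ 2 * rho ^+ 2) + 76.
have x1 : 0 <= 540 / eta by rewrite divr_ge0 // ltW.
have x2 : 0 <= 576 / eps ^+ 2 by rewrite divr_ge0 // exprn_ge0 // ltW.
have x3 : 0 <= (1216 * 144) / (eta ^+ 2 * rho ^+ 2).
  by rewrite divr_ge0 // mulr_ge0 // exprn_ge0 // ltW.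
have x0 : 0 <= x by rewrite !addr_ge0.
pose L := (Num.truncn x).+1.
have xL : x <= L%:R by have /andP[_ /ltW] := truncn_itv x0.
have y0 : 0 <= 4 * L.+1%:R / eta by rewrite divr_ge0 ?mulr_ge0 // ltW.
pose K := (Num.truncn (4 * L.+1%:R / eta)).+1.
have /andP[K_le K_ge] := truncn_itv y0; rewrite -/K in K_ge.
have L1 : 1 <= L%:R :> R by rewrite ler1n.
have L540 : 540 / eta <= L%:R by apply: le_trans xL; rewrite /x; lra.
have L576 : 576 / eps ^+ 2 <= L%:R by apply: le_trans xL; rewrite /x; lra.
have Lrho : (1216 * 144) / (eta ^+ 2 * rho ^+ 2) <= L%:R by apply: le_trans xL; rewrite /x; lra.
have L76 : 76 <= L%:R :> R by apply: le_trans xL; rewrite /x; lra.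
have LK : 4 * L.+1%:R <= eta * K%:R.
  by move: K_ge; rewrite ltr_pdivrMr // [K%:R * _]mulrC => /ltW.
have etaK : eta * K%:R <= 9 * L%:R.
  have K_le' : K%:R <= 4 * L.+1%:R / eta + 1 by rewrite /K -[X in X <= _]natr1 lerD2r.
  apply: le_trans (ler_wpM2l (ltW t0) K_le') _.
  rewrite mulrDr mulr1 mulrC divfK ?gt_eqF // -natr1; lra.
have LleK : L%:R <= K%:R :> R.
  rewrite -(ler_pM2l t0); apply: le_trans LK; rewrite -natr1.
  have : eta * L%:R <= 1 * L%:R by rewrite ler_wpM2r //; lra.
  lra.
exists K, L; split; split=> //.
- by rewrite -(ler_nat R); apply: le_trans LleK.
- by move: L576; rewrite ler_pdivrMr ?exprn_gt0 // => /le_trans; apply; rewrite ler_wpM2r ?sqr_ge0.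
- have : (1216 * 144) <= K%:R * (eta ^+ 2 * rho ^+ 2).
    rewrite -ler_pdivrMr; first exact: le_trans LleK.
    by rewrite mulr_gt0 // exprn_gt0.
  by rewrite expr2; lra.
- apply: (@le_trans _ _ (L%:R * L%:R)).
    apply: (@le_trans _ _ (540 / eta * L%:R)); last by rewrite ler_wpM2r.
    by rewrite mulrAC ler_pdivlMr //; lra.
  have L2 : L%:R <= 2 ^+ L :> R by rewrite -natrX ler_nat ltnW // ltn_expl.
  have -> : (4 : R) ^+ L = 2 ^+ L * 2 ^+ L by rewrite -exprMn; congr (_ ^+ _); ring.
  by rewrite ler_pM.
by lra.
Qed.

Theorem theorem1p14 (R : realType) (eps eta rho : R)
    (heps : 0 < eps < 1 / 2) (heta : 0 < eta < 1 / 4) (hrho : 0 < rho < 1 / 4) :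
  exists (K : nat) (c mu M : R) (n0 : nat),
    [/\ (1 <= K)%N, 0 < c, 0 < mu & 0 < M] /\
    forall (n : nat) (p : R),
      (n0 <= n)%N -> 0 < p <= 1 -> M <= p * n%:R ->
    forall (V : finType) (G : sgraph V) (beta : R),
      #|V| = n -> bijumbled p beta G -> beta <= c * p * n%:R ->
    forall H : sgraph V,
      absolute_Dirac eps p H G \/
      (relative_Dirac eps H G /\
       (1 - eps / 4) * p * n%:R <= (min_degree G)%:R) ->
    forall Gamma : conflict_graph H,
      (max_degree Gamma)%:R <= mu * p * n%:R ->
    exists lambda : {ffun sgraph V -> R},
      [/\ probability_on (conflict_free_subgraphs Gamma) lambda,
          forall F : sgraph V, F \in law_support lambda ->
            [/\ sparse eta rho (K%:R / n%:R) F,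
                (1 / 2 + eps / 4) * K%:R <= (min_degree F)%:R
              & (num_edges F)%:R <= 2 * K%:R * n%:R :> R]
        & forall S : {set {set V}}, S \subset edges H ->
            prob lambda [pred F : sgraph V | S \subset edges F]
              <= (K%:R / (p * n%:R)) ^+ #|S| * (4 / 3) ^+ #|cover S|
              <= (16 * K%:R / (9 * (p * n%:R))) ^+ #|S|].

Proof.
have [K [L [[L0 K76 Keps] [Krho KL kK LK]]]] := exists_sizes heps heta hrho.
have [/andP[e0 e1] /andP[t0 t1] /andP[r0 r1]] := And3 heps heta hrho.
have K0 : 0 < K%:R :> R by rewrite ltr0n (leq_trans _ K76).
(* Small enough for 8 c <= eta rho, for c <= k = eta/144 and for 16 c^2 <= eps. *)
pose c : R := eta * rho * eps / 32.
have tr : eta * rho <= 1 / 4 * (1 / 4) by apply: ler_pM; lra.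
have re : rho * eps <= 1 / 4 * (1 / 2) by apply: ler_pM; lra.
have c0 : 0 < c by rewrite divr_gt0 // !mulr_gt0.
have ceps : c <= eps / 512.
  have : eta * rho * eps <= 1 / 16 * eps by rewrite ler_wpM2r ?(ltW e0) //; lra.
  by rewrite /c; lra.
have ceta : 8 * c <= eta * rho.
  have : eta * rho * eps <= eta * rho * 1.
    by rewrite ler_wpM2l ?mulr_ge0 ?(ltW t0) ?(ltW r0) //; lra.
  by rewrite /c; have : 0 < eta * rho by [rewrite mulr_gt0]; lra.
have ck : c <= eta / 144.
  have : eta * (rho * eps) <= eta * (1 / 8) by rewrite ler_wpM2l ?(ltW t0) //; lra.
  by rewrite /c; lra.
have c2 : 16 * c ^+ 2 <= eps.
  have : c * c <= 1 * (eps / 512) by apply: ler_pM; lra.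
  by rewrite expr2; lra.
clearbody c.
pose mu : R := (30 * K%:R ^+ 2)^-1.
have mu0 : 0 < mu by rewrite invr_gt0 mulr_gt0 ?exprn_gt0.
have muK : 30 * mu * K%:R ^+ 2 <= 1.
  by rewrite mulrAC mulfV // gt_eqF // mulr_gt0 ?exprn_gt0.
(* The three terms of M give q < 1, p n >= 1 and eps p n >= 8. *)
exists K, c, mu, (K%:R + 1 + 8 / eps), 3%N; split.
  by split=> //; [exact: leq_trans K76 | rewrite !addr_gt0 ?divr_gt0].
move=> n p n3 /andP[p0 p1] Mpn V G beta VN jG cbeta H HG Gamma Gmu.
have nE : n%:R = #|V|%:R :> R by rewrite VN.
have e80 : 0 < 8 / eps by rewrite divr_gt0.
have pn1 : 1 <= p * n%:R by lra.
have epn : 8 <= eps * (p * n%:R).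
  by rewrite mulrC -ler_pdivrMr //; lra.
have pn0 : 0 < p * n%:R by lra.
have HsubG : spanning_subgraph H G by case: HG => [[]|[[]]].
have jH : upper_jumbled p c H.
  move=> A B; apply: (@le_trans _ _ (edges_between G A B)%:R).
    by rewrite ler_nat edges_between_sub.
  rewrite -nE -lerBlDl; apply: le_trans (ler_norm _) _; apply: le_trans (jG A B) _.
  by rewrite ler_wpM2r ?sqrtr_ge0.
have degH v : (1 / 2 + 3 / 4 * eps) * (p * n%:R) <= (deg H v)%:R.
  have step a b : a <= b -> a * (p * n%:R) <= b * (p * n%:R) by move=> ?; rewrite ler_wpM2r // ltW.
  case: HG => [[_ dH]|[[_ relH] dG]].
    apply: (@le_trans _ _ (min_degree H)%:R); last by rewrite ler_nat min_degree_le.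
    by apply: le_trans dH; rewrite -nE -[leRHS]mulrA step //; lra.
  (* In the relative case (1/2 + eps) (1 - eps/4) >= 1/2 + 3 eps/4, because eps <= 1/2. *)
  apply: le_trans (relH v); have dGv : (1 - eps / 4) * p * n%:R <= (deg G v)%:R.
    by apply: le_trans dG _; rewrite ler_nat min_degree_le.
  apply: le_trans (ler_wpM2l _ dGv); last by lra.
  rewrite -[(1 - _) * p * _]mulrA [leRHS]mulrA step //.
  have : eps * eps <= 1 / 2 * eps by rewrite ler_wpM2r ?(ltW e0) ?(ltW e1).
  lra.
rewrite nE in epn degH.
have [H' H'H degH'] := bounded_degree_subgraph p0 (ltW c0) jH heps c2 epn degH.
have jH' : upper_jumbled p c H'.
  by move=> A B; apply: le_trans (jH A B); rewrite ler_nat edges_between_sub.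
rewrite -nE in degH'.
pose q : R := K%:R / (p * n%:R).
have q1 : q < 1 by rewrite ltr_pdivrMr // mul1r; lra.
rewrite -mulrA in Gmu; rewrite -VN in n3.
(* Edges are sampled from the thinned H', while [Gamma] remains a conflict graph on H. *)
exists (sample H' Gamma (eta / 144) eps eta rho K L n%:R q); split.
- exact: (sample_probability nE (erefl q) p0 pn1 q1 heps heta hrho n3 L0 K76 Keps Krho KL kK
    ck ceta (ltW mu0) muK H'H jH' degH' Gmu).
- move=> F /sample_support[X -> aX]; split.
  + exact: (acceptable_sparse nE heta hrho n3 K76 LK aX).
  + exact: (acceptable_degree nE (erefl q) pn1 q1 heps n3 degH' aX).
  + exact: (acceptable_edges aX).
move=> S SH; apply/andP; split.
  exact: (sample_spread nE (erefl q) p0 pn1 q1 heps heta hrho n3 L0 K76 Keps Krho KL kK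
    ck ceta (ltW mu0) muK H'H jH' degH' Gmu SH).
(* A set S of edges covers at most 2 |S| vertices. *)
have -> : 16 * K%:R / (9 * (p * n%:R)) = q * (4 / 3) ^+ 2.
  by rewrite /q; move: (p * n%:R) pn0 => x x0; field; lra.
rewrite [leRHS]exprMn ler_wpM2l ?exprn_ge0 ?divr_ge0 ?(ltW pn0) // -exprM.
rewrite ler_weXn2l //; first lra.
by apply: card_cover_le => e /(subsetP SH)/edge_card.
Qed.
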